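(* The functions $$f(x)=\psi(x+1)-x\psi'\biggl(1+\frac{x}2\biggr)\quad\text{and}\quad g(x)=x\psi'\bigl(\sqrt{x+1}\,\bigr)-\psi(x+1)$$ are both strictly increasing on $(-1,\infty)$, with limits $$\lim_{x\to-1^+}f(x)=-\infty,\qquad \lim_{x\to-1^+}g(x)=1+\gamma-\frac{\pi^2}6,\qquad \lim_{x\to\infty}f(x)=\lim_{x\to\infty}g(x)=\infty.$$
   Context: $\Gamma$ is Euler's gamma function, $\psi(x)=\Gamma'(x)/\Gamma(x)$ is the psi (digamma) function, $\psi'$ is its derivative, and $\gamma=0.577\ldots$ is the Euler–Mascheroni constant. *)

(* Defs.v *)
From Stdlib Require Import Reals.
From Coquelicot Require Import Coquelicot.

Local Open Scope R_scope.

(** Euler's integral of the second kind; it converges exactly for [x > 0], and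
    only positive arguments are relevant below. *)
Definition Gamma (x : R) : R :=
  RInt_gen (fun t : R => Rpower t (x - 1) * exp (- t))
           (at_right 0) (Rbar_locally p_infty).

Definition psi (x : R) : R := Derive Gamma x / Gamma x.

Definition psi' (x : R) : R := Derive psi x.

Definition euler_mascheroni : R :=
  real (Lim_seq (fun n : nat => sum_n_m (fun k : nat => / INR k) 1 n - ln (INR n))).

Definition fct_f (x : R) : R := psi (x + 1) - x * psi' (1 + x / 2).

Definition fct_g (x : R) : R := x * psi' (sqrt (x + 1)) - psi (x + 1).

Definition strictly_increasing_on (D : R -> Prop) (h : R -> R) : Prop :=
  forall x y : R, D x -> D y -> x < y -> h x < h y.

(* Main.v *)
Require Import Defs.
From Stdlib Require Import Reals Lra Lia Classical.
From Coquelicot Require Import Coquelicot.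
Local Open Scope R_scope.

(** The proof rests on the partial fraction series, valid for [z > 0],

      [psi z = - gamma + sum_(m >= 1) (1/m - 1/(m - 1 + z))],
      [psi' z = sum_(n >= 0) 1/(n + z)^2].

    Substituting them and combining the fractions, every term of [f] and [g]
    simplifies drastically:

      [f x + gamma = sum_(m >= 1) x^3 / (m (m + x) (2 m + x)^2)],
      [g x - gamma = sum_(n >= 1)
           n (s + 1) (s - 1)^3 / ((n + s)^2 (n + 1) (n + s^2))],  [s = sqrt (x + 1)].

    Each term is by itself strictly increasing in [x], respectively [s]
    ([f_term_increasing], [g_term_increasing]), which gives monotonicity of the sums.
    The limits come from the same series. At -1 the first term of [f] has a pole
    and all others are negative; at infinity the terms of [f] with [m <= x] add up
    to at least a fixed fraction of the harmonic sum, and those of [g] with [n <= s] are bounded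
    below by a constant. As [s] tends to 0 the series for [g] converges, uniformly,
    to the sum of [- 1/(n^2 (n + 1)) = (1/n - 1/(n + 1)) - 1/n^2], which is
    [1 - PI^2/6].

    The series for [psi] is reached through [ln Gamma]. Integrating Bernoulli's
    inequality [(t/a)^y <= 1 - y + y t/a] against the Gamma integrand gives
    [Gamma (a + y) <= a^y Gamma a] for [0 <= y <= 1] ([Gamma_add_le]). Together with
    the functional equation this pins down the growth of [Gamma (n + z)]
    ([gauss_defect_lim]) and hence yields Weierstrass' series for [ln Gamma]
    ([ln_Gamma_series]), which is differentiated twice term by term
    ([is_derive_Series]). In particular the differentiability of [Gamma] is read off
    the series rather than from the integral.

    The sum of inverse squares ([basel_series]) is obtained from the identity
    [1/sin^2 t + 1/cos^2 t = 4/sin^2 (2 t)], which evaluates the sum of [1/sin^2]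
    over the odd multiples of [PI / 2^(n+2)] in [(0, PI/2)], and from
    [1/sin^2 t - 1 <= 1/t^2 <= 1/sin^2 t]. *)

(** * Euler's integral *)

Lemma ln_le_sub_1 (x : R) : 0 < x -> ln x <= x - 1.
Proof.
  intros Hx.
  assert (H := exp_ineq1_le (ln x)). rewrite exp_ln in H by exact Hx. lra.
Qed.

Lemma ex_RInt_positive_reals (f : R -> R) (a b : R) :
  (forall t, 0 < t -> continuous f t) -> 0 < a -> 0 < b -> ex_RInt f a b.
Proof.
  intros Hc Ha Hb. apply (ex_RInt_continuous f). intros t Ht. apply Hc.
  assert (0 < Rmin a b) by (apply Rmin_glb_lt; assumption). lra.
Qed.

(** The integrals over [[a, b]] grow as the interval grows, so they converge to
    their supremum along the product filter. *)
Lemma ex_RInt_gen_nonneg_bounded (f : R -> R) (M : R) :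
  (forall t, 0 < t -> continuous f t) ->
  (forall t, 0 < t -> 0 <= f t) ->
  (forall a b, 0 < a < b -> RInt f a b <= M) ->
  ex_RInt_gen f (at_right 0) (Rbar_locally p_infty).
Proof.
  intros Hc Hp HM.
  assert (Hi : forall a b, 0 < a -> 0 < b -> ex_RInt f a b)
    by (intros; now apply ex_RInt_positive_reals).
  destruct (completeness (fun v => exists a b, 0 < a < b /\ v = RInt f a b))
    as [l [Hub Hlub]].
  { exists M. intros v (a & b & Hab & ->). now apply HM. }
  { exists (RInt f 1 2), 1, 2. split; [lra|reflexivity]. }
  exists l. intros P [eps HP].
  assert (Hex : exists a b, 0 < a < b /\ l - eps < RInt f a b).
  { destruct (classic
      (exists a b, 0 < a < b /\ l - eps < RInt f a b)) as [H|H]; [exact H|].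
    exfalso. assert (Hl : l <= l - eps).
    { apply Hlub. intros v (a & b & Hab & ->).
      destruct (Rle_or_lt (RInt f a b) (l - eps)) as [H'|H']; [exact H'|].
      exfalso; apply H; now exists a, b. }
    destruct eps as [e He]; simpl in *; lra. }
  destruct Hex as (a0 & b0 & [Ha0 Hab0] & Hlt).
  apply (Filter_prod _ _ _ (fun a => 0 < a < a0) (fun b => b0 < b)).
  - exists (mkposreal a0 Ha0). intros y Hy Hy0. split; [exact Hy0|].
    apply Rabs_lt_between' in Hy. simpl in Hy. lra.
  - now exists b0.
  - intros a b [Ha Haa] Hb. exists (RInt f a b). split.
    + apply (RInt_correct f). apply Hi; simpl; lra.
    + apply HP. apply Rabs_lt_between'.
      assert (H1 : RInt f a b = RInt f a a0 + RInt f a0 b0 + RInt f b0 b).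
      { rewrite <- (RInt_Chasles f a a0 b) by (apply Hi; lra).
        rewrite <- (RInt_Chasles f a0 b0 b) by (apply Hi; lra).
        unfold plus; simpl; ring. }
      assert (0 <= RInt f a a0).
      { apply RInt_ge_0; [lra|apply Hi; lra|]. intros; apply Hp; lra. }
      assert (0 <= RInt f b0 b).
      { apply RInt_ge_0; [lra|apply Hi; lra|]. intros; apply Hp; lra. }
      assert (RInt f a b <= l).
      { apply Hub. exists a, b. split; [lra|reflexivity]. }
      destruct eps as [e He]; simpl in *; lra.
Qed.

Definition gamma_integrand (x t : R) : R := Rpower t (x - 1) * exp (- t).

Lemma is_derive_Rpower_l (p t : R) : 0 < t ->
  is_derive (fun t => Rpower t p) t (p * Rpower t (p - 1)).
Proof.
  intros Ht. apply is_derive_Reals. now apply derivable_pt_lim_power.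
Qed.

Lemma Rpower_sub_1 (t p : R) : 0 < t -> Rpower t p = Rpower t (p - 1) * t.
Proof.
  intros Ht. rewrite <- (Rpower_1 t) at 3 by exact Ht.
  rewrite <- Rpower_plus. f_equal; ring.
Qed.

Lemma Rpower_pos (t p : R) : 0 < Rpower t p.
Proof. apply exp_pos. Qed.

Lemma gamma_integrand_pos (x t : R) : 0 < gamma_integrand x t.
Proof. apply Rmult_lt_0_compat; apply exp_pos. Qed.

Lemma continuous_gamma_integrand (x t : R) : 0 < t ->
  continuous (gamma_integrand x) t.
Proof.
  intros Ht. apply (continuous_mult (K := R_AbsRing)).
  - apply (ex_derive_continuous (fun t => Rpower t (x - 1))). eexists.
    now apply is_derive_Rpower_l.
  - apply (ex_derive_continuous (fun t => exp (- t))). auto_derive. exact I.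
Qed.

(** The maximum over [t] of [p * ln (1 + t) - t] is bounded by applying
    [ln u <= u - 1] at [u = (1 + t) / p], where [t = p - 1] gives equality. The
    decay at infinity is measured in powers of [1 + t] so that a single estimate
    serves near 0 and near infinity. *)
Lemma Rpower_1p_exp_bound (p t : R) : 0 < p -> 0 <= t ->
  Rpower (1 + t) p * exp (- t) <= exp (p * ln p + 1 - p).
Proof.
  intros Hp Ht. unfold Rpower. rewrite <- exp_plus.
  assert (H : p * ln (1 + t) + - t <= p * ln p + 1 - p).
  { assert (H := ln_le_sub_1 ((1 + t) / p)).
    assert (0 < (1 + t) / p) by (apply Rdiv_lt_0_compat; lra).
    specialize (H H0). rewrite ln_div in H by lra.
    apply (Rmult_le_compat_l p) in H; [|lra].
    replace (p * ((1 + t) / p - 1)) with (1 + t - p) in H by (field; lra). lra. }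
  destruct H as [H|H]; [left; now apply exp_increasing|right; now rewrite H].
Qed.

(** The integrand is dominated by [C * t^(x-1) / (1 + t)^(x+1)], which has the
    bounded primitive [C / x * (t / (1 + t))^x]; this handles both ends of the
    range at once. *)
Lemma ex_Gamma (x : R) : 0 < x ->
  ex_RInt_gen (gamma_integrand x) (at_right 0) (Rbar_locally p_infty).
Proof.
  intros Hx. set (C := exp ((x + 1) * ln (x + 1) + 1 - (x + 1))).
  apply ex_RInt_gen_nonneg_bounded with (M := C / x).
  - intros; now apply continuous_gamma_integrand.
  - intros; left; apply gamma_integrand_pos.
  - intros a b Hab.
    (* H is the bounded primitive and h its derivative. *)
    set (H := fun t => C / x * Rpower (t / (1 + t)) x).
    set (h := fun t => C * Rpower (t / (1 + t)) (x - 1) * / (1 + t) ^ 2).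
    assert (HD : forall t, 0 < t -> is_derive H t (h t)).
    { intros t Ht. unfold H, h.
      evar (d : R). replace (C * _ * _) with d; unfold d.
      - apply (is_derive_scal (fun t => Rpower (t / (1 + t)) x)).
        apply (is_derive_comp (fun u => Rpower u x) (fun t => t / (1 + t))).
        + apply is_derive_Rpower_l. apply Rdiv_lt_0_compat; lra.
        + auto_derive; [lra|reflexivity].
      - unfold scal; simpl; unfold mult; simpl. field. lra. }
    assert (Hcont : forall t, 0 < t -> continuous h t).
    { intros t Ht. apply (ex_derive_continuous h). unfold h.
      apply ex_derive_mult; [apply ex_derive_scal|auto_derive; nra].
      eexists. apply (is_derive_comp (fun u => Rpower u (x-1)) (fun t => t / (1 + t))).
      + apply is_derive_Rpower_l. apply Rdiv_lt_0_compat; lra.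
      + auto_derive; [lra|reflexivity]. }
    assert (HI : is_RInt h a b (H b - H a)).
    { apply (is_RInt_derive H); intros t Ht; rewrite Rmin_left, Rmax_right in Ht by lra.
      - apply HD; lra.
      - apply Hcont; lra. }
    apply Rle_trans with (RInt h a b).
    + apply RInt_le; [lra| |eexists; exact HI|].
      * apply ex_RInt_positive_reals; try lra.
        intros; now apply continuous_gamma_integrand.
      * intros t Ht. unfold gamma_integrand, h.
        assert (Hb := Rpower_1p_exp_bound (x + 1) t ltac:(lra) ltac:(lra)).
        fold C in Hb.
        assert (E1 : Rpower (t / (1 + t)) (x - 1) * Rpower (1 + t) (x - 1)
                    = Rpower t (x - 1)).
        { rewrite Rpower_mult_distr; [|apply Rdiv_lt_0_compat; lra|lra].
          f_equal. field; lra. }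
        assert (E2 : Rpower (1 + t) (x + 1) = Rpower (1 + t) (x - 1) * (1 + t) ^ 2).
        { rewrite (Rpower_sub_1 (1+t) (x+1)) by lra.
          rewrite (Rpower_sub_1 (1+t) (x+1-1)) by lra.
          replace (x + 1 - 1 - 1) with (x - 1) by ring. ring. }
        rewrite <- E1. rewrite E2 in Hb.
        assert (P := Rpower_pos (t / (1+t)) (x-1)).
        apply Rmult_le_reg_r with ((1+t)^2); [nra|].
        rewrite (Rmult_assoc (C * _)), Rinv_l, Rmult_1_r by nra.
        apply (Rmult_le_compat_l _ _ _ (Rlt_le _ _ P)) in Hb. lra.
    + rewrite (is_RInt_unique _ _ _ _ HI). unfold H.
      assert (0 < C) by apply exp_pos.
      assert (0 < C / x) by (apply Rdiv_lt_0_compat; lra).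
      assert (P := Rpower_pos (a / (1+a)) x).
      assert (Rpower (b / (1+b)) x <= 1).
      { apply Rle_trans with (Rpower 1 x).
        2:{ right. unfold Rpower. rewrite ln_1, Rmult_0_r. apply exp_0. }
        apply Rle_Rpower_l; [lra|]. split; [apply Rdiv_lt_0_compat; lra|].
        apply Rmult_le_reg_r with (1 + b); [lra|]. unfold Rdiv.
        rewrite Rmult_assoc, Rinv_l; lra. }
      nra.
Qed.

Lemma is_RInt_gen_Gamma (x : R) : 0 < x ->
  is_RInt_gen (gamma_integrand x) (at_right 0) (Rbar_locally p_infty) (Gamma x).
Proof. intros Hx. apply (RInt_gen_correct (gamma_integrand x)). now apply ex_Gamma. Qed.

(** Truncated integrals over intervals containing [[1, 2]] are bounded below by
    the positive integral over [[1, 2]], so their limit cannot be nonpositive. *)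
Lemma Gamma_pos (x : R) : 0 < x -> 0 < Gamma x.
Proof.
  intros Hx.
  assert (Hc : forall a b, 0 < a -> 0 < b -> ex_RInt (gamma_integrand x) a b).
  { intros. apply ex_RInt_positive_reals; try assumption.
    intros; now apply continuous_gamma_integrand. }
  assert (Hp : 0 < RInt (gamma_integrand x) 1 2).
  { apply RInt_gt_0; [lra| |].
    - intros; apply gamma_integrand_pos.
    - intros; apply continuous_gamma_integrand; lra. }
  apply Rnot_le_lt. intros Hle.
  destruct (is_RInt_gen_Gamma x Hx (fun y => y < RInt (gamma_integrand x) 1 2))
    as [Q P HQ HP H].
  { apply open_lt. lra. }
  destruct HP as [B HP]. destruct HQ as [d HQ].
  assert (Hd := cond_pos d).
  set (a := Rmin (d / 2) 1). set (b := Rmax (B + 1) 2).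
  assert (Ha : 0 < a <= 1 /\ a <= d / 2).
  { unfold a; repeat split; [apply Rmin_glb_lt; lra|apply Rmin_r|apply Rmin_l]. }
  assert (Hb : 2 <= b /\ B + 1 <= b).
  { unfold b; split; [apply Rmax_r|apply Rmax_l]. }
  destruct (H a b) as (y & Hy & Hlt).
  { apply HQ; [|lra]. apply Rabs_lt_between'. lra. }
  { apply HP. lra. }
  apply (is_RInt_unique (V := R_CompleteNormedModule)) in Hy. simpl in Hy. subst y.
  rewrite <- (RInt_Chasles _ a 1 b) in Hlt by (apply Hc; lra).
  rewrite <- (RInt_Chasles _ 1 2 b) in Hlt by (apply Hc; lra).
  assert (0 <= RInt (gamma_integrand x) a 1).
  { apply RInt_ge_0; [lra|apply Hc; lra|]. intros; left; apply gamma_integrand_pos. }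
  assert (0 <= RInt (gamma_integrand x) 2 b).
  { apply RInt_ge_0; [lra|apply Hc; lra|]. intros; left; apply gamma_integrand_pos. }
  unfold plus in Hlt; simpl in Hlt. lra.
Qed.

Lemma filter_prod_pos :
  filter_prod (at_right 0) (Rbar_locally p_infty)
    (fun ab : R * R => 0 < fst ab < snd ab).
Proof.
  apply (Filter_prod _ _ _ (fun a => 0 < a < 1) (fun b => 1 < b)).
  - exists (mkposreal 1 Rlt_0_1). intros y Hy Hy0. split; [exact Hy0|].
    apply Rabs_lt_between' in Hy. simpl in Hy. lra.
  - now exists 1.
  - simpl; intros; lra.
Qed.

Lemma boundary_term_0 (x : R) : 0 < x ->
  filterlim (fun t => - (Rpower t x * exp (- t))) (at_right 0) (locally 0).
Proof.
  intros Hx. apply filterlim_locally. intros eps.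
  assert (He : 0 < Rpower eps (/ x)) by apply Rpower_pos.
  exists (mkposreal _ He). intros t Ht Ht0.
  apply Rabs_lt_between' in Ht. simpl in Ht.
  apply Rabs_lt_between'.
  assert (P := Rpower_pos t x).
  assert (0 < exp (- t)) by apply exp_pos.
  assert (exp (- t) < 1) by (rewrite <- exp_0; apply exp_increasing; lra).
  assert (Rpower t x <= eps).
  { apply Rle_trans with (Rpower (Rpower eps (/ x)) x).
    - apply Rle_Rpower_l; lra.
    - rewrite Rpower_mult, Rinv_l, Rpower_1; [lra|apply cond_pos|lra]. }
  assert (0 < eps) by apply cond_pos. nra.
Qed.

Lemma boundary_term_infty (x : R) : 0 < x ->
  filterlim (fun t => - (Rpower t x * exp (- t))) (Rbar_locally p_infty) (locally 0).
Proof.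
  intros Hx. apply filterlim_locally. intros eps.
  set (C := exp ((x + 1) * ln (x + 1) + 1 - (x + 1))).
  assert (HC : 0 < C) by apply exp_pos.
  assert (He := cond_pos eps).
  exists (C / eps). intros t Ht.
  assert (0 < C / eps) by (apply Rdiv_lt_0_compat; lra).
  apply Rabs_lt_between'.
  assert (Hb := Rpower_1p_exp_bound (x + 1) t ltac:(lra) ltac:(lra)).
  fold C in Hb.
  rewrite (Rpower_sub_1 (1+t) (x+1)) in Hb by lra.
  replace (x + 1 - 1) with x in Hb by ring.
  assert (Rpower t x <= Rpower (1 + t) x) by (apply Rle_Rpower_l; lra).
  assert (P := Rpower_pos t x).
  assert (0 < exp (- t)) by apply exp_pos.
  assert (C < t * eps).
  { apply Rmult_lt_reg_r with (/ eps); [now apply Rinv_0_lt_compat|].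
    rewrite Rmult_assoc, Rinv_r by lra. unfold Rdiv in Ht; lra. }
  assert (0 < Rpower t x * exp (-t)) by nra.
  assert (Rpower t x * exp (-t) <= Rpower (1+t) x * exp (-t)) by nra.
  assert (Rpower (1+t) x * exp (-t) * (1 + t) < eps * (1 + t)) by lra.
  apply Rmult_lt_reg_r in H5; lra.
Qed.

(** Integration by parts, in the form of integrating the derivative
    [t^x exp(-t) - x t^(x-1) exp(-t)] of [- t^x exp(-t)], whose boundary values
    vanish. *)
Lemma Gamma_succ (x : R) : 0 < x -> Gamma (x + 1) = x * Gamma x.
Proof.
  intros Hx.
  set (F := fun t => - (Rpower t x * exp (- t))).
  set (h := fun t => minus (gamma_integrand (x + 1) t) (scal x (gamma_integrand x t))).
  assert (HD : forall t, 0 < t -> is_derive F t (h t)).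
  { intros t Ht. unfold F, h, gamma_integrand. 
    replace (x + 1 - 1) with x by ring.
    evar (d : R). replace (minus _ _) with d; unfold d.
    - apply (is_derive_opp (fun t => Rpower t x * exp (- t))).
      apply (is_derive_mult (fun t => Rpower t x) (fun t => exp (- t))).
      + now apply is_derive_Rpower_l.
      + auto_derive; [exact I|reflexivity].
      + apply Rmult_comm.
    - unfold minus, plus, opp, scal, mult; simpl. unfold mult; simpl. ring. }
  assert (H1 : is_RInt_gen (Derive F) (at_right 0) (Rbar_locally p_infty) (0 - 0)).
  { apply is_RInt_gen_Derive.
    - eapply filter_imp; [|exact filter_prod_pos]. intros [a b] Hab t Ht.
      simpl in *. rewrite Rmin_left in Ht by lra. eexists; apply HD; lra.
    - eapply filter_imp; [|exact filter_prod_pos]. intros [a b] Hab t Ht.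
      simpl in *. rewrite Rmin_left in Ht by lra.
      apply (continuous_ext_loc _ h).
      + apply (filter_imp (fun u => 0 < u)); [|apply open_gt; lra].
        intros u Hu. symmetry. apply is_derive_unique. now apply HD.
      + apply (continuous_minus (V := R_NormedModule)).
        * apply continuous_gamma_integrand; lra.
        * apply (continuous_scal_r (V := R_NormedModule)).
          apply continuous_gamma_integrand; lra.
    - now apply boundary_term_0.
    - now apply boundary_term_infty. }
  assert (H2 : is_RInt_gen h (at_right 0) (Rbar_locally p_infty) (0 - 0)).
  { eapply is_RInt_gen_ext; [|exact H1].
    eapply filter_imp; [|exact filter_prod_pos]. intros [a b] Hab t Ht.
    simpl in *. rewrite Rmin_left in Ht by lra. apply is_derive_unique, HD; lra. }
  assert (H3 : is_RInt_gen h (at_right 0) (Rbar_locally p_infty)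
                 (minus (Gamma (x + 1)) (scal x (Gamma x)))).
  { apply (is_RInt_gen_minus (gamma_integrand (x + 1))
             (fun t => scal x (gamma_integrand x t))).
    - apply is_RInt_gen_Gamma; lra.
    - apply (is_RInt_gen_scal (gamma_integrand x)). now apply is_RInt_gen_Gamma. }
  apply (is_RInt_gen_unique (V := R_CompleteNormedModule)) in H2.
  apply (is_RInt_gen_unique (V := R_CompleteNormedModule)) in H3.
  rewrite H2 in H3. unfold minus, plus, opp, scal in H3; simpl in H3.
  unfold mult in H3; simpl in H3. lra.
Qed.

Lemma Rpower_le_tangent (u y : R) : 0 < u -> 0 <= y <= 1 ->
  Rpower u y <= 1 - y + y * u.
Proof.
  intros Hu Hy. unfold Rpower.
  set (s := 1 - y + y * u).
  assert (Hs : 0 < s) by (unfold s; nra).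
  assert (H1 := ln_le_sub_1 (/ s) (Rinv_0_lt_compat _ Hs)).
  assert (H2 : 0 < u / s) by (apply Rdiv_lt_0_compat; lra).
  apply ln_le_sub_1 in H2. rewrite ln_div in H2 by lra. rewrite ln_Rinv in H1 by lra.
  (* Concavity of ln: average the two tangent-line bounds at s. *)
  assert (H3 : y * ln u <= ln s).
  { assert (E : (1 - y) * (/ s - 1) + y * (u / s - 1) = 0).
    { unfold Rdiv. replace ((1 - y) * (/ s - 1) + y * (u * / s - 1))
        with (s * / s - 1) by (unfold s at 1; ring). rewrite Rinv_r; lra. }
    assert ((1 - y) * - ln s <= (1 - y) * (/ s - 1)) by (apply Rmult_le_compat_l; lra).
    assert (y * (ln u - ln s) <= y * (u / s - 1)) by (apply Rmult_le_compat_l; lra).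
    lra. }
  rewrite <- (exp_ln s) by exact Hs.
  destruct H3 as [H3|H3]; [left; now apply exp_increasing|right; now rewrite H3].
Qed.

(** Wendel's inequality. It replaces log-convexity of Gamma: integrating the
    pointwise bound [(t/a)^y <= 1 - y + y t/a] against [t^(a-1) exp(-t)] and using
    [Gamma (a + 1) = a Gamma a] makes the right-hand side collapse to [Gamma a]. *)
Lemma Gamma_add_le (a y : R) : 0 < a -> 0 <= y <= 1 ->
  Gamma (a + y) <= Rpower a y * Gamma a.
Proof.
  intros Ha Hy.
  set (g := fun t => plus (scal (Rpower a y * (1 - y)) (gamma_integrand a t))
                          (scal (Rpower a y * (y / a)) (gamma_integrand (a + 1) t))).
  assert (Hg : is_RInt_gen g (at_right 0) (Rbar_locally p_infty)
                 (plus (scal (Rpower a y * (1 - y)) (Gamma a))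
                       (scal (Rpower a y * (y / a)) (Gamma (a + 1))))).
  { apply (is_RInt_gen_plus (fun t => scal (Rpower a y * (1 - y)) (gamma_integrand a t))
             (fun t => scal (Rpower a y * (y / a)) (gamma_integrand (a + 1) t))).
    - apply (is_RInt_gen_scal (gamma_integrand a)). now apply is_RInt_gen_Gamma.
    - apply (is_RInt_gen_scal (gamma_integrand (a + 1))). apply is_RInt_gen_Gamma; lra. }
  assert (H : norm (Gamma (a + y)) <= plus (scal (Rpower a y * (1 - y)) (Gamma a))
                       (scal (Rpower a y * (y / a)) (Gamma (a + 1)))).
  { apply (RInt_gen_norm (Fa := at_right 0) (Fb := Rbar_locally p_infty)
             (gamma_integrand (a + y)) g); [| |apply is_RInt_gen_Gamma; lra|exact Hg].
    - eapply filter_imp; [|exact filter_prod_pos]. simpl; intros; lra.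
    - eapply filter_imp; [|exact filter_prod_pos]. intros [l r] Hlr t Ht. simpl in *.
      unfold norm; simpl. unfold abs; simpl.
      rewrite Rabs_pos_eq by (left; apply gamma_integrand_pos).
      unfold g, plus, scal; simpl; unfold mult; simpl.
      unfold gamma_integrand.
      replace (a + 1 - 1) with a by ring.
      rewrite (Rpower_sub_1 t a) by lra.
      replace (a + y - 1) with ((a - 1) + y) by ring.
      rewrite Rpower_plus.
      assert (E : Rpower t y = Rpower a y * Rpower (t / a) y).
      { rewrite Rpower_mult_distr; [f_equal; field; lra|lra|].
        apply Rdiv_lt_0_compat; lra. }
      rewrite E.
      assert (Hb := Rpower_le_tangent (t / a) y ltac:(apply Rdiv_lt_0_compat; lra) Hy).
      assert (P : 0 < Rpower a y * Rpower t (a - 1) * exp (- t)).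
      { repeat apply Rmult_lt_0_compat; apply exp_pos. }
      apply (Rmult_le_compat_l _ _ _ (Rlt_le _ _ P)) in Hb.
      eapply Rle_trans; [|eapply Rle_trans; [exact Hb|]]; right; [ring|field; lra]. }
  unfold norm in H; simpl in H; unfold abs in H; simpl in H.
  rewrite Rabs_pos_eq in H by (left; apply Gamma_pos; lra).
  unfold plus, scal in H; simpl in H; unfold mult in H; simpl in H.
  rewrite Gamma_succ in H by exact Ha.
  eapply Rle_trans; [exact H|]. right. field. lra.
Qed.

(** * The value of the sum of inverse squares *)

(** Sums of the first [N] terms, with [psum a 0 = 0]: the empty sum keeps the
    power-of-two index ranges and the telescoping arguments free of off-by-one
    corrections. *)
Fixpoint psum (a : nat -> R) (N : nat) : R :=
  match N with
  | O => 0
  | S k => psum a k + a k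
  end.

Lemma psum_ext (a b : nat -> R) (N : nat) :
  (forall k, (k < N)%nat -> a k = b k) -> psum a N = psum b N.
Proof.
  induction N as [|N IH]; intros H; [reflexivity|].
  simpl. rewrite IH by (intros; apply H; lia). now rewrite H by lia.
Qed.

Lemma psum_le (a b : nat -> R) (N : nat) :
  (forall k, (k < N)%nat -> a k <= b k) -> psum a N <= psum b N.
Proof.
  induction N as [|N IH]; intros H; [simpl; lra|]. simpl.
  apply Rplus_le_compat; [apply IH; intros; apply H; lia|apply H; lia].
Qed.

Lemma psum_plus (a b : nat -> R) (N : nat) :
  psum (fun k => a k + b k) N = psum a N + psum b N.
Proof. induction N as [|N IH]; simpl; [ring|rewrite IH; ring]. Qed.

Lemma psum_scal (c : R) (a : nat -> R) (N : nat) :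
  psum (fun k => c * a k) N = c * psum a N.
Proof. induction N as [|N IH]; simpl; [ring|rewrite IH; ring]. Qed.

Lemma psum_const (c : R) (N : nat) : psum (fun _ => c) N = INR N * c.
Proof. induction N as [|N IH]; [simpl; ring|]. rewrite S_INR. simpl. rewrite IH; ring. Qed.

Lemma psum_shift (a : nat -> R) (N : nat) :
  psum a (S N) = a 0%nat + psum (fun k => a (S k)) N.
Proof.
  induction N as [|N IH]; [simpl; ring|].
  change (psum a (S (S N))) with (psum a (S N) + a (S N)). rewrite IH. simpl. ring.
Qed.

Lemma psum_fold (a : nat -> R) (N : nat) :
  psum a (2 * N) = psum (fun k => a k + a (2 * N - 1 - k)%nat) N.
Proof.
  revert a; induction N as [|N IH]; intros a; [reflexivity|].
  replace (2 * S N)%nat with (S (S (2 * N))) by lia.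
  rewrite psum_shift.
  change (psum (fun k => a (S k)) (S (2 * N))) with
    (psum (fun k => a (S k)) (2 * N) + a (S (2 * N))).
  rewrite IH, psum_shift.
  replace (S (S (2 * N)) - 1 - 0)%nat with (S (2 * N)) by lia.
  rewrite (psum_ext (fun k => a (S k) + a (S (2 * N - 1 - k)))
                    (fun k => a (S k) + a (S (S (2 * N)) - 1 - S k)%nat)).
  - ring.
  - intros k Hk. do 2 f_equal. lia.
Qed.

Lemma psum_even_odd (a : nat -> R) (N : nat) :
  psum a (2 * N) = psum (fun k => a (2 * k)%nat) N + psum (fun k => a (2 * k + 1)%nat) N.
Proof.
  induction N as [|N IH]; [simpl; ring|].
  replace (2 * S N)%nat with (S (S (2 * N))) by lia.
  change (psum a (S (S (2 * N)))) with (psum a (2 * N) + a (2 * N)%nat + a (S (2 * N))).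
  rewrite IH. cbn [psum]. replace (2 * N + 1)%nat with (S (2 * N)) by lia. ring.
Qed.

Lemma sum_n_psum (a : nat -> R) (n : nat) : sum_n a n = psum a (S n).
Proof.
  induction n as [|n IH]; [rewrite sum_O; simpl; ring|].
  rewrite sum_Sn, IH. reflexivity.
Qed.

Lemma is_series_psum (a : nat -> R) (l : R) :
  is_series a l <-> is_lim_seq (psum a) l.
Proof.
  rewrite is_lim_seq_incr_1.
  split; intros H.
  - apply (is_lim_seq_ext (sum_n a)); [apply sum_n_psum|exact H].
  - apply (is_lim_seq_ext _ (sum_n a)) in H; [exact H|].
    intros n; symmetry; apply sum_n_psum.
Qed.

Lemma x_cos_le_sin (x : R) : 0 <= x <= PI / 2 -> x * cos x <= sin x.
Proof.
  intros Hx.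
  destruct (MVT_gen (fun t => sin t - t * cos t) 0 x (fun t => t * sin t))
    as (c & Hc & E).
  - intros t _. auto_derive; [exact I|ring].
  - intros t _. apply continuity_pt_filterlim.
    apply (ex_derive_continuous (fun t => sin t - t * cos t)). auto_derive. exact I.
  - rewrite Rmin_left, Rmax_right in Hc by lra.
    rewrite sin_0 in E.
    assert (0 <= sin c) by (apply sin_ge_0; assert (H := PI_RGT_0); lra).
    assert (0 <= c * sin c * (x - 0)) by (repeat apply Rmult_le_pos; lra).
    lra.
Qed.

Definition csc2 (x : R) : R := / sin x ^ 2.

(** From [1/sin^2 + 1/cos^2 = 1/(sin^2 cos^2)] and the double-angle formula:
    pairing an angle with its complement doubles the angle and multiplies by 4. *)
Lemma csc2_fold (x : R) : 0 < x < PI / 2 ->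
  csc2 x + csc2 (PI / 2 - x) = 4 * csc2 (2 * x).
Proof.
  intros Hx. unfold csc2.
  rewrite sin_shift, sin_2a.
  assert (0 < sin x) by (apply sin_gt_0; lra).
  assert (0 < cos x) by (apply cos_gt_0; lra).
  assert (E := sin2_cos2 x). unfold Rsqr in E.
  replace (/ sin x ^ 2 + / cos x ^ 2)
    with ((sin x * sin x + cos x * cos x) * / (sin x ^ 2 * cos x ^ 2)) by (field; lra).
  rewrite E. field. lra.
Qed.

Lemma csc2_bounds (x : R) : 0 < x < PI / 2 -> csc2 x - 1 <= / x ^ 2 <= csc2 x.
Proof.
  intros Hx. unfold csc2.
  assert (Hs : 0 < sin x) by (apply sin_gt_0; lra).
  assert (Hc : 0 < cos x) by (apply cos_gt_0; lra).
  assert (E := sin2_cos2 x). unfold Rsqr in E.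
  assert (H1 := sin_lt_x x ltac:(lra)).
  assert (H2 := x_cos_le_sin x ltac:(lra)).
  split.
  - replace (/ sin x ^ 2 - 1) with (((sin x * sin x + cos x * cos x) - sin x ^ 2) * / sin x ^ 2)
      by (rewrite E; field; lra).
    apply Rmult_le_reg_r with (sin x ^ 2 * x ^ 2); [apply Rmult_lt_0_compat; apply pow_lt; lra|].
    replace ((sin x * sin x + cos x * cos x - sin x ^ 2) * / sin x ^ 2 * (sin x ^ 2 * x ^ 2))
      with ((x * cos x) ^ 2) by (field; lra).
    replace (/ x ^ 2 * (sin x ^ 2 * x ^ 2)) with (sin x ^ 2) by (field; lra).
    apply pow_incr. split; [apply Rmult_le_pos; lra|exact H2].
  - apply Rinv_le_contravar; [apply pow_lt; lra|]. apply pow_incr; lra.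
Qed.

(** The [2^n] odd multiples of [PI / 2^(n+2)] that lie in [(0, PI/2)]. *)
Definition odd_angle (n k : nat) : R := (2 * INR k + 1) * PI / 2 ^ (n + 2).

Lemma odd_angle_range (n k : nat) : (k < 2 ^ n)%nat -> 0 < odd_angle n k < PI / 2.
Proof.
  intros Hk. unfold odd_angle.
  assert (HP := PI_RGT_0). assert (H2 : 0 < 2 ^ n) by (apply pow_lt; lra).
  assert (H0 := pos_INR k).
  assert (Hk' : INR k + 1 <= 2 ^ n).
  { rewrite <- S_INR. change 2 with (INR 2). rewrite <- pow_INR. apply le_INR. lia. }
  rewrite pow_add. split.
  - apply Rdiv_lt_0_compat; nra.
  - replace (PI / 2) with (2 * 2 ^ n * PI / (2 ^ n * 2 ^ 2)) by (field; lra).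
    unfold Rdiv. apply Rmult_lt_compat_r; [apply Rinv_0_lt_compat; nra|].
    apply Rmult_lt_compat_r; lra.
Qed.

(** The angles of level [n + 1] split into complementary pairs, and doubling one
    angle of each pair gives the angles of level [n]; so each level multiplies the
    sum by 4, starting from [csc2 (PI/4) = 2]. *)
Lemma sum_csc2 (n : nat) : psum (fun k => csc2 (odd_angle n k)) (2 ^ n) = 2 * 4 ^ n.
Proof.
  induction n as [|n IH].
  - simpl. unfold odd_angle, csc2. simpl.
    replace ((2 * 0 + 1) * PI / (2 * (2 * 1))) with (PI / 4) by field.
    rewrite sin_PI4. assert (H := sqrt_lt_R0 2 ltac:(lra)).
    assert (E := sqrt_sqrt 2 ltac:(lra)).
    rewrite Rmult_1_r. replace (1 / sqrt 2 * (1 / sqrt 2)) with (/ (sqrt 2 * sqrt 2)).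
    + rewrite E. field.
    + field. lra.
  - replace (2 ^ S n)%nat with (2 * 2 ^ n)%nat by reflexivity.
    rewrite psum_fold.
    rewrite (psum_ext _ (fun k => 4 * csc2 (odd_angle n k))).
    + rewrite psum_scal, IH. simpl. ring.
    + intros k Hk.
      assert (H2 : (2 : R) ^ n <> 0) by (apply pow_nonzero; lra).
      assert (Hr := odd_angle_range (S n) k ltac:(simpl; lia)).
      replace (odd_angle (S n) (2 * 2 ^ n - 1 - k)) with (PI / 2 - odd_angle (S n) k).
      * rewrite csc2_fold by exact Hr. do 2 f_equal. unfold odd_angle.
        rewrite !pow_add. simpl. field. exact H2.
      * unfold odd_angle. rewrite !minus_INR, mult_INR, pow_INR by lia.
        change (INR 2) with 2. change (INR 1) with 1.
        rewrite !pow_add. simpl. field. exact H2.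
Qed.

(** Summing [csc2 t - 1 <= 1/t^2 <= csc2 t] over the odd angles of level [n]: the
    gap is [2^n], negligible against the sum [2 * 4^n]. *)
Lemma sum_odd_inv_sq_bounds (n : nat) :
  PI ^ 2 / 8 * (1 - / 2 * (/ 2) ^ n) <= psum (fun k => / (2 * INR k + 1) ^ 2) (2 ^ n)
    <= PI ^ 2 / 8.
Proof.
  assert (HP := PI_RGT_0). assert (H2 : 0 < 2 ^ n) by (apply pow_lt; lra).
  assert (E4 : 4 ^ n = 2 ^ n * 2 ^ n) by (rewrite <- Rpow_mult_distr; f_equal; lra).
  set (c := 16 * 4 ^ n / PI ^ 2).
  assert (Hc : 0 < c) by (unfold c; apply Rdiv_lt_0_compat; [rewrite E4|apply pow_lt]; nra).
  assert (E : psum (fun k => / odd_angle n k ^ 2) (2 ^ n)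
              = c * psum (fun k => / (2 * INR k + 1) ^ 2) (2 ^ n)).
  { rewrite <- psum_scal. apply psum_ext. intros k _. unfold odd_angle, c.
    rewrite pow_add, E4. assert (H0 := pos_INR k). field. repeat split; lra. }
  assert (U : psum (fun k => / odd_angle n k ^ 2) (2 ^ n) <= 2 * 4 ^ n).
  { rewrite <- sum_csc2. apply psum_le. intros k Hk.
    apply csc2_bounds. now apply odd_angle_range. }
  assert (L : 2 * 4 ^ n - 2 ^ n <= psum (fun k => / odd_angle n k ^ 2) (2 ^ n)).
  { replace (2 * 4 ^ n - 2 ^ n)
      with (psum (fun k => csc2 (odd_angle n k) + -1) (2 ^ n)).
    - apply psum_le. intros k Hk. apply csc2_bounds. now apply odd_angle_range.
    - rewrite psum_plus, sum_csc2, psum_const, pow_INR. change (INR 2) with 2. ring. }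
  rewrite E in U, L.
  split; apply Rmult_le_reg_l with c; try exact Hc.
  - replace (c * (PI ^ 2 / 8 * (1 - / 2 * (/ 2) ^ n))) with (2 * 4 ^ n - 2 ^ n).
    + exact L.
    + unfold c. rewrite E4, pow_inv. field. lra.
  - replace (c * (PI ^ 2 / 8)) with (2 * 4 ^ n); [exact U|]. unfold c. field. lra.
Qed.

Lemma psum_incr (a : nat -> R) : (forall n, 0 <= a n) ->
  forall M N, (M <= N)%nat -> psum a M <= psum a N.
Proof.
  intros Ha M N H. induction H as [|N H IH]; [lra|]. simpl. specialize (Ha N). lra.
Qed.

(** The bounds are available only at powers of two; monotonicity of the partial
    sums transfers the limit from this subsequence to the whole sequence. *)
Lemma series_odd_inv_sq : is_lim_seq (psum (fun k => / (2 * INR k + 1) ^ 2)) (PI ^ 2 / 8).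
Proof.
  set (a := fun k => / (2 * INR k + 1) ^ 2).
  assert (Ha : forall k, 0 <= a k).
  { intros k. left. apply Rinv_0_lt_compat, pow_lt. assert (H := pos_INR k). lra. }
  destruct (ex_finite_lim_seq_incr (psum a) (PI ^ 2 / 8)) as [l Hl].
  - intros n. apply psum_incr; [exact Ha|lia].
  - intros n. eapply Rle_trans; [apply (psum_incr a Ha n (2 ^ n))|apply sum_odd_inv_sq_bounds].
    apply Nat.lt_le_incl, Nat.pow_gt_lin_r; lia.
  - replace (PI ^ 2 / 8) with l; [exact Hl|].
    assert (H1 : is_lim_seq (fun n => psum a (2 ^ n)) l).
    { apply (is_lim_seq_subseq (psum a)); [|exact Hl].
      apply eventually_subseq. intros n. apply Nat.pow_lt_mono_r; lia. }
    assert (H2 : is_lim_seq (fun n => psum a (2 ^ n)) (PI ^ 2 / 8)).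
    { apply (is_lim_seq_le_le (fun n => PI ^ 2 / 8 * (1 - / 2 * (/ 2) ^ n)) _
               (fun _ => PI ^ 2 / 8)).
      - intros n. apply sum_odd_inv_sq_bounds.
      - replace (PI ^ 2 / 8) with (PI ^ 2 / 8 * (1 - / 2 * 0)) at 1 by field.
        apply (is_lim_seq_scal_l _ _ (Finite _)).
        apply is_lim_seq_minus'; [apply is_lim_seq_const|].
        apply (is_lim_seq_scal_l _ _ (Finite 0)). apply is_lim_seq_geom.
        rewrite Rabs_pos_eq; lra.
      - apply is_lim_seq_const. }
    apply is_lim_seq_unique in H1. apply is_lim_seq_unique in H2. congruence.
Qed.

(** Splitting into odd and even denominators gives [Z = PI^2/8 + Z/4] for the
    sum [Z]. *)
Lemma basel_series : is_series (fun n => / (INR n + 1) ^ 2) (PI ^ 2 / 6).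
Proof.
  apply is_series_psum.
  set (a := fun k => / (INR k + 1) ^ 2). set (o := fun k => / (2 * INR k + 1) ^ 2).
  assert (Hpos : forall k, 0 <= INR k) by apply pos_INR.
  assert (Ha : forall k, 0 <= a k).
  { intros k. left. apply Rinv_0_lt_compat, pow_lt. specialize (Hpos k). lra. }
  assert (E : forall N, psum a (2 * N) = psum o N + / 4 * psum a N).
  { intros N. rewrite psum_even_odd, <- psum_scal. f_equal; apply psum_ext; intros k _;
      unfold a, o; specialize (Hpos k); rewrite ?plus_INR, mult_INR;
      change (INR 2) with 2; [reflexivity|]. simpl (INR 1). field. lra. }
  assert (Ho : forall N, psum o N <= PI ^ 2 / 8).
  { intros N. apply (is_lim_seq_incr_compare _ _ series_odd_inv_sq).
    intros n. apply psum_incr; [|lia].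
    intros k. left. apply Rinv_0_lt_compat, pow_lt. specialize (Hpos k). lra. }
  destruct (ex_finite_lim_seq_incr (psum a) (PI ^ 2 / 6)) as [l Hl].
  - intros n. apply psum_incr; [exact Ha|lia].
  - intros n. specialize (Ho n). specialize (E n).
    assert (H := psum_incr a Ha n (2 * n) ltac:(lia)). lra.
  - replace (PI ^ 2 / 6) with l; [exact Hl|].
    assert (H1 : is_lim_seq (fun n => psum a (2 * n)) l).
    { apply (is_lim_seq_subseq (psum a)); [|exact Hl].
      apply eventually_subseq. intros n. lia. }
    assert (H2 : is_lim_seq (fun n => psum a (2 * n)) (PI ^ 2 / 8 + / 4 * l)).
    { apply (is_lim_seq_ext (fun n => psum o n + / 4 * psum a n)).
      - intros n; now rewrite E.
      - apply is_lim_seq_plus'; [apply series_odd_inv_sq|].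
        now apply (is_lim_seq_scal_l _ _ (Finite l)). }
    apply is_lim_seq_unique in H1. apply is_lim_seq_unique in H2.
    rewrite H1 in H2. injection H2. lra.
Qed.

(** * The series for ln Gamma *)

Lemma ln_diff_bounds (a b : R) : 0 < a -> 0 < b ->
  (b - a) / b <= ln b - ln a <= (b - a) / a.
Proof.
  intros Ha Hb. split.
  - assert (H := ln_le_sub_1 (a / b) ltac:(now apply Rdiv_lt_0_compat)).
    rewrite ln_div in H by lra.
    replace ((b - a) / b) with (- (a / b - 1)) by (field; lra). lra.
  - assert (H := ln_le_sub_1 (b / a) ltac:(now apply Rdiv_lt_0_compat)).
    rewrite ln_div in H by lra.
    replace ((b - a) / a) with (b / a - 1) by (field; lra). lra.
Qed.

Lemma ex_series_inv_sq_bound (a : nat -> R) (C : R) :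
  (forall n, Rabs (a n) <= C * / (INR n + 1) ^ 2) -> ex_series a.
Proof.
  intros H. apply (ex_series_le (V := R_CompleteNormedModule) a
    (fun n => C * / (INR n + 1) ^ 2)).
  - exact H.
  - apply (ex_series_scal_l (V := R_NormedModule)). eexists. apply basel_series.
Qed.

(** With [k = min 1 z], this compares every denominator [n + z] with [n + 1], so
    that the series below are all dominated by the sum of [1/(n+1)^2]. *)
Lemma add_ge_scaled (k z : R) (n : nat) : k <= 1 -> k <= z ->
  k * (INR n + 1) <= INR n + z.
Proof. intros H1 H2. assert (H := pos_INR n). nra. Qed.

Lemma is_lim_seq_inv_shift (c z : R) : is_lim_seq (fun n => c / (INR n + z)) 0.
Proof.
  replace (Finite 0) with (Rbar_mult c (Rbar_inv p_infty)).
  2:{ simpl. f_equal. ring. }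
  apply is_lim_seq_scal_l. apply is_lim_seq_inv; [|discriminate].
  eapply is_lim_seq_plus; [apply is_lim_seq_INR|apply is_lim_seq_const|reflexivity].
Qed.

Lemma is_lim_seq_ln_shift (z : R) : 0 < z ->
  is_lim_seq (fun n => ln (INR n + z) - ln (INR n + 1)) 0.
Proof.
  intros Hz.
  apply (is_lim_seq_le_le (fun n => (z - 1) / (INR n + z)) _
           (fun n => (z - 1) / (INR n + 1))); try apply is_lim_seq_inv_shift.
  intros n. assert (H := pos_INR n).
  destruct (ln_diff_bounds (INR n + 1) (INR n + z) ltac:(lra) ltac:(lra)) as [H1 H2].
  replace (INR n + z - (INR n + 1)) with (z - 1) in H1, H2 by ring. lra.
Qed.

Lemma ln_Gamma_succ (x : R) : 0 < x -> ln (Gamma (x + 1)) = ln (Gamma x) + ln x.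
Proof.
  intros Hx. rewrite Gamma_succ, ln_mult by (try apply Gamma_pos; assumption). ring.
Qed.

Lemma ln_Gamma_shift (z : R) (N : nat) : 0 < z ->
  ln (Gamma (INR N + z)) = ln (Gamma z) + psum (fun k => ln (INR k + z)) N.
Proof.
  intros Hz. induction N as [|N IH]; [simpl; rewrite Rplus_0_l; ring|].
  rewrite S_INR. replace (INR N + 1 + z) with (INR N + z + 1) by ring.
  assert (H := pos_INR N).
  rewrite ln_Gamma_succ, IH by lra. simpl. ring.
Qed.

(** The logarithm of [Gamma (n + z) / (Gamma (n + 1) * (n + 1)^(z - 1))]. That it
    tends to 0 is what singles out Gamma among the solutions of the functional
    equation. *)
Definition gauss_defect (z : R) (n : nat) : R :=
  ln (Gamma (INR n + z)) - ln (Gamma (INR n + 1)) - (z - 1) * ln (INR n + 1).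

(** Writing [z = 1 + y] and [a = n + 1], the inequality [Gamma_add_le] from [a] to
    [a + y] gives the upper bound 0, and from [a + y] to [a + 1] it gives the lower
    bound [- (1 - y) (ln (a + y) - ln a) >= - 1/a]. *)
Lemma gauss_defect_lim_base (z : R) : 1 <= z <= 2 -> is_lim_seq (gauss_defect z) 0.
Proof.
  intros Hz. set (y := z - 1).
  apply (is_lim_seq_le_le (fun n => -1 / (INR n + 1)) _ (fun _ => 0)).
  - intros n. assert (Hn := pos_INR n). unfold gauss_defect.
    set (a := INR n + 1). assert (Ha : 0 < a) by (unfold a; lra).
    replace (INR n + z) with (a + y) by (unfold a, y; ring). fold y.
    assert (Hy : 0 <= y <= 1) by (unfold y; lra).
    assert (P1 := Gamma_pos a Ha). assert (P2 := Gamma_pos (a + y) ltac:(lra)).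
    assert (U := Gamma_add_le a y Ha Hy).
    assert (L := Gamma_add_le (a + y) (1 - y) ltac:(lra) ltac:(lra)).
    replace (a + y + (1 - y)) with (a + 1) in L by ring.
    apply ln_le in U; [|exact P2]. apply ln_le in L; [|apply Gamma_pos; lra].
    rewrite ln_Gamma_succ in L by exact Ha.
    rewrite ln_mult in U, L by (assumption || apply exp_pos).
    unfold Rpower in U, L. rewrite ln_exp in U, L.
    destruct (ln_diff_bounds a (a + y) Ha ltac:(lra)) as [H1 H2].
    assert (H3 : ln (a + y) - ln a <= 1 / a).
    { eapply Rle_trans; [exact H2|]. unfold Rdiv.
      apply Rmult_le_compat_r; [left; now apply Rinv_0_lt_compat|lra]. }
    assert (H4 : 0 <= ln (a + y) - ln a).
    { eapply Rle_trans; [|exact H1]. apply Rdiv_le_0_compat; lra. }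
    replace (-1 / a) with (- (1 / a)) by (field; lra).
    split; nra.
  - apply is_lim_seq_inv_shift.
  - apply is_lim_seq_const.
Qed.

Lemma gauss_defect_succ (z : R) (n : nat) : 0 < z ->
  gauss_defect (z + 1) n = gauss_defect z n + (ln (INR n + z) - ln (INR n + 1)).
Proof.
  intros Hz. unfold gauss_defect. assert (H := pos_INR n).
  rewrite <- Rplus_assoc, ln_Gamma_succ by lra. ring.
Qed.

(** The functional equation carries the limit from [[1, 2]] to each later unit
    interval, and back by one step to [(0, 1)]. *)
Lemma gauss_defect_lim (z : R) : 0 < z -> is_lim_seq (gauss_defect z) 0.
Proof.
  assert (Hup : forall k z, INR k + 1 <= z <= INR k + 2 -> is_lim_seq (gauss_defect z) 0).
  { induction k as [|k IH]; intros x Hx.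
    - apply gauss_defect_lim_base. simpl in Hx. lra.
    - rewrite S_INR in Hx. assert (Hk := pos_INR k).
      apply (is_lim_seq_ext (fun n => gauss_defect (x - 1) n
                               + (ln (INR n + (x - 1)) - ln (INR n + 1)))).
      + intros n. rewrite <- gauss_defect_succ by lra. f_equal; ring.
      + replace 0 with (0 + 0) by ring.
        apply is_lim_seq_plus'; [apply IH; lra|apply is_lim_seq_ln_shift; lra]. }
  intros Hz.
  assert (Hge : forall x, 1 <= x -> is_lim_seq (gauss_defect x) 0).
  { intros x Hx. destruct (nfloor_ex (x - 1)) as [k Hk]; [lra|].
    apply (Hup k). lra. }
  destruct (Rle_or_lt 1 z) as [H|H]; [now apply Hge|].
  apply (is_lim_seq_ext (fun n => gauss_defect (z + 1) n
                           - (ln (INR n + z) - ln (INR n + 1)))).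
  - intros n. rewrite gauss_defect_succ by lra. ring.
  - replace 0 with (0 - 0) by ring.
    apply is_lim_seq_minus'; [apply Hge; lra|now apply is_lim_seq_ln_shift].
Qed.

Definition ln_Gamma_term (z : R) (n : nat) : R :=
  (z - 1) / (INR n + 1) - (ln (INR n + z) - ln (INR n + 1)).

Lemma ex_series_ln_Gamma (z : R) : 0 < z -> ex_series (ln_Gamma_term z).
Proof.
  intros Hz. set (k := Rmin 1 z).
  assert (Hk : 0 < k) by (apply Rmin_glb_lt; lra).
  assert (Hk1 : k <= 1) by apply Rmin_l. assert (Hkz : k <= z) by apply Rmin_r.
  apply ex_series_inv_sq_bound with (C := (z - 1) ^ 2 / k).
  intros n. unfold ln_Gamma_term.
  assert (Hn := pos_INR n). assert (Hs := add_ge_scaled k z n Hk1 Hkz).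
  destruct (ln_diff_bounds (INR n + 1) (INR n + z) ltac:(lra) ltac:(lra)) as [H1 H2].
  replace (INR n + z - (INR n + 1)) with (z - 1) in H1, H2 by ring.
  rewrite Rabs_pos_eq by lra.
  apply Rle_trans with ((z - 1) / (INR n + 1) - (z - 1) / (INR n + z)); [lra|].
  replace ((z - 1) / (INR n + 1) - (z - 1) / (INR n + z))
    with ((z - 1) ^ 2 * / ((INR n + 1) * (INR n + z))) by (field; lra).
  unfold Rdiv. rewrite Rmult_assoc, <- Rinv_mult.
  apply Rmult_le_compat_l; [apply pow2_ge_0|].
  apply Rinv_le_contravar; [apply Rmult_lt_0_compat; [lra|apply pow_lt; lra]|nra].
Qed.

Definition harmonic (n : nat) : R := psum (fun k => / (INR k + 1)) n.

(** At [z = 2] the partial sums of [ln_Gamma_term] telescope to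
    [harmonic n - ln (n + 1)], so convergence of that series gives existence of the
    limit that defines the constant. *)
Lemma harmonic_sub_ln_lim :
  is_lim_seq (fun n => harmonic n - ln (INR n + 1)) euler_mascheroni.
Proof.
  assert (Hex := ex_series_ln_Gamma 2 ltac:(lra)). destruct Hex as [l Hl].
  apply is_series_psum in Hl.
  assert (Hl' : is_lim_seq (fun n => harmonic n - ln (INR n + 1)) l).
  { apply (is_lim_seq_ext (psum (ln_Gamma_term 2))); [|exact Hl].
    unfold harmonic. induction n as [|n IH].
    - simpl. rewrite Rplus_0_l, ln_1. ring.
    - cbn [psum]. rewrite IH, S_INR. unfold ln_Gamma_term.
      replace (INR n + 1 + 1) with (INR n + 2) by ring. unfold Rdiv. ring. }
  replace euler_mascheroni with l; [exact Hl'|].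
  unfold euler_mascheroni.
  rewrite (is_lim_seq_unique _ l); [reflexivity|].
  apply is_lim_seq_incr_1.
  apply (is_lim_seq_ext (fun n => (harmonic n - ln (INR n + 1)) + 1 / (INR n + 1))).
  - intros n. rewrite S_INR.
    replace (sum_n_m (fun k => / INR k) 1 (S n)) with (harmonic (S n)).
    + unfold harmonic. cbn [psum]. unfold Rdiv. ring.
    + unfold harmonic. rewrite <- sum_n_psum.
      rewrite <- (sum_n_m_S (fun k => / INR k)).
      unfold sum_n. apply sum_n_m_ext. intros k. now rewrite S_INR.
  - replace l with (l + 0) by ring.
    apply is_lim_seq_plus'; [exact Hl'|apply is_lim_seq_inv_shift].
Qed.

(** Weierstrass' product in logarithmic form. By the functional equation the
    partial sum equals [ln (Gamma z) - ln (Gamma 1)] plus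
    [(z - 1) (harmonic n - ln (n + 1))] minus the defect. The term
    [ln (Gamma 1)] is an additive constant, which differentiation removes. *)
Lemma ln_Gamma_series (z : R) : 0 < z ->
  ln (Gamma z) = ln (Gamma 1) - euler_mascheroni * (z - 1) + Series (ln_Gamma_term z).
Proof.
  intros Hz.
  assert (H : Series (ln_Gamma_term z)
     = (z - 1) * euler_mascheroni - 0 + (ln (Gamma z) - ln (Gamma 1))); [|rewrite H; ring].
  apply is_series_unique, is_series_psum.
  apply (is_lim_seq_ext (fun n => (z - 1) * (harmonic n - ln (INR n + 1))
           - gauss_defect z n + (ln (Gamma z) - ln (Gamma 1)))).
  - intros n. unfold gauss_defect. rewrite !ln_Gamma_shift by lra.
    unfold harmonic. set (l := ln (INR n + 1)).
    enough (E : psum (ln_Gamma_term z) n = (z - 1) * psum (fun k => / (INR k + 1)) n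
       - psum (fun k => ln (INR k + z)) n + psum (fun k => ln (INR k + 1)) n)
      by (rewrite E; ring).
    clear l. induction n as [|n IH]; [simpl; ring|].
    cbn [psum]. rewrite IH. unfold ln_Gamma_term, Rdiv. ring.
  - apply is_lim_seq_plus'; [|apply is_lim_seq_const].
    apply is_lim_seq_minus'; [|now apply gauss_defect_lim].
    apply (is_lim_seq_scal_l _ _ (Finite _)). apply harmonic_sub_ln_lim.
Qed.

Lemma Series_Rabs_le (a b : nat -> R) :
  (forall n, Rabs (a n) <= b n) -> ex_series b -> Rabs (Series a) <= Series b.
Proof.
  intros H Hb. eapply Rle_trans; [apply Series_Rabs|].
  - apply (ex_series_le (V := R_CompleteNormedModule) _ b); [|exact Hb].
    intros n. unfold norm; simpl; unfold abs; simpl. now rewrite Rabs_Rabsolu.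
  - apply Series_le; [|exact Hb]. intros n. split; [apply Rabs_pos|apply H].
Qed.

(** Summing first-order Taylor remainders: if they are dominated by
    [(y - x)^2 c_n] with [c_n] summable, then so is the remainder of the sum, by
    [(y - x)^2] times a constant. *)
Lemma is_derive_Series (u : R -> nat -> R) (du c : nat -> R) (x d : R) : 0 < d ->
  (forall y, Rabs (y - x) < d -> ex_series (u y)) -> ex_series du -> ex_series c ->
  (forall y n, Rabs (y - x) < d ->
     Rabs (u y n - u x n - (y - x) * du n) <= (y - x) ^ 2 * c n) ->
  is_derive (fun y => Series (u y)) x (Series du).
Proof.
  intros Hd Hu Hdu Hc Hb. apply is_derive_Reals. intros eps Heps.
  set (C := Rabs (Series c) + 1).
  assert (HC : 0 < C) by (unfold C; assert (H := Rabs_pos (Series c)); lra).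
  assert (Hdel : 0 < Rmin d (eps / C)).
  { apply Rmin_glb_lt; [exact Hd|now apply Rdiv_lt_0_compat]. }
  exists (mkposreal _ Hdel). simpl. intros h Hh0 Hh.
  assert (Hh1 : Rabs (x + h - x) < d).
  { replace (x + h - x) with h by ring. eapply Rlt_le_trans; [exact Hh|apply Rmin_l]. }
  assert (Hx : ex_series (u x)) by (apply Hu; rewrite Rminus_diag, Rabs_R0; exact Hd).
  assert (E : (Series (u (x + h)) - Series (u x)) / h - Series du
              = Series (fun n => u (x + h) n - u x n - h * du n) / h).
  { rewrite Series_minus, Series_minus, Series_scal_l; auto.
    - field. exact Hh0.
    - apply (ex_series_minus (V := R_NormedModule)); auto.
    - now apply (ex_series_scal_l (V := R_NormedModule)). }
  rewrite E. unfold Rdiv. rewrite Rabs_mult, Rabs_inv.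
  assert (Hp : 0 < Rabs h) by now apply Rabs_pos_lt.
  apply Rmult_lt_reg_r with (Rabs h); [exact Hp|].
  rewrite Rmult_assoc, Rinv_l, Rmult_1_r by lra.
  apply Rle_lt_trans with (h ^ 2 * Series c).
  - rewrite <- Series_scal_l. apply Series_Rabs_le.
    + intros n. specialize (Hb (x + h) n Hh1).
      replace (x + h - x) with h in Hb by ring. exact Hb.
    + now apply (ex_series_scal_l (V := R_NormedModule)).
  - assert (Hhe : Rabs h < eps / C) by (eapply Rlt_le_trans; [exact Hh|apply Rmin_r]).
    apply (Rmult_lt_compat_r C) in Hhe; [|exact HC].
    unfold Rdiv in Hhe. rewrite Rmult_assoc, Rinv_l, Rmult_1_r in Hhe by lra.
    rewrite <- pow2_abs. assert (H := Rle_abs (Series c)). unfold C in Hhe. nra.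
Qed.

Definition psi_term (z : R) (n : nat) : R := 1 / (INR n + 1) - 1 / (INR n + z).
Definition psi'_term (z : R) (n : nat) : R := / (INR n + z) ^ 2.

Lemma ex_series_psi (z : R) : 0 < z -> ex_series (psi_term z).
Proof.
  intros Hz. set (k := Rmin 1 z).
  assert (Hk : 0 < k) by (apply Rmin_glb_lt; lra).
  assert (Hk1 : k <= 1) by apply Rmin_l. assert (Hkz : k <= z) by apply Rmin_r.
  apply ex_series_inv_sq_bound with (C := Rabs (z - 1) / k).
  intros n. unfold psi_term.
  assert (Hn := pos_INR n). assert (Hs := add_ge_scaled k z n Hk1 Hkz).
  replace (1 / (INR n + 1) - 1 / (INR n + z))
    with ((z - 1) * / ((INR n + 1) * (INR n + z))) by (field; lra).
  rewrite Rabs_mult, (Rabs_pos_eq (/ _)).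
  - unfold Rdiv. rewrite Rmult_assoc, <- Rinv_mult.
    apply Rmult_le_compat_l; [apply Rabs_pos|].
    apply Rinv_le_contravar; [apply Rmult_lt_0_compat; [lra|apply pow_lt; lra]|nra].
  - left. apply Rinv_0_lt_compat. nra.
Qed.

Lemma ex_series_psi' (z : R) : 0 < z -> ex_series (psi'_term z).
Proof.
  intros Hz. set (k := Rmin 1 z).
  assert (Hk : 0 < k) by (apply Rmin_glb_lt; lra).
  assert (Hk1 : k <= 1) by apply Rmin_l. assert (Hkz : k <= z) by apply Rmin_r.
  apply ex_series_inv_sq_bound with (C := / k ^ 2).
  intros n. unfold psi'_term.
  assert (Hn := pos_INR n). assert (Hs := add_ge_scaled k z n Hk1 Hkz).
  rewrite Rabs_pos_eq by (left; apply Rinv_0_lt_compat, pow_lt; lra).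
  rewrite <- Rinv_mult, <- Rpow_mult_distr.
  apply Rinv_le_contravar; [apply pow_lt; nra|]. apply pow_incr. nra.
Qed.

Lemma half_neighbourhood (z y : R) : Rabs (y - z) < z / 2 -> z / 2 < y.
Proof. intros H. apply Rabs_lt_between in H. lra. Qed.

Lemma is_derive_ln_Gamma_series (z : R) : 0 < z ->
  is_derive (fun y => Series (ln_Gamma_term y)) z (Series (psi_term z)).
Proof.
  intros Hz. set (k := Rmin 1 (z / 2)).
  assert (Hk : 0 < k) by (apply Rmin_glb_lt; lra).
  assert (Hk1 : k <= 1) by apply Rmin_l. assert (Hkz : k <= z / 2) by apply Rmin_r.
  apply (is_derive_Series ln_Gamma_term (psi_term z)
           (fun n => / k ^ 2 * / (INR n + 1) ^ 2) z (z / 2)).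
  - lra.
  - intros y Hy. apply ex_series_ln_Gamma. apply half_neighbourhood in Hy. lra.
  - now apply ex_series_psi.
  - apply (ex_series_scal_l (V := R_NormedModule)). eexists. apply basel_series.
  - intros y n Hy. apply half_neighbourhood in Hy.
    assert (Hn := pos_INR n).
    assert (Hs := add_ge_scaled k z n Hk1 ltac:(lra)).
    assert (Hs' := add_ge_scaled k y n Hk1 ltac:(lra)).
    unfold ln_Gamma_term, psi_term.
    set (a := INR n + z) in *. set (b := INR n + y) in *. set (m := INR n + 1) in *.
    assert (Hm : 1 <= m) by (unfold m; lra).
    replace (y - z) with (b - a) by (unfold a, b; ring).
    assert (Ha : 0 < a) by nra. assert (Hb : 0 < b) by nra.
    replace ((y - 1) / m - (ln b - ln m) - ((z - 1) / m - (ln a - ln m))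
             - (b - a) * (1 / m - 1 / a)) with ((b - a) / a - (ln b - ln a)).
    2:{ unfold a, b. field. unfold a in Ha. unfold m. lra. }
    destruct (ln_diff_bounds a b Ha Hb) as [H1 H2].
    rewrite Rabs_pos_eq by lra.
    apply Rle_trans with ((b - a) / a - (b - a) / b); [lra|].
    replace ((b - a) / a - (b - a) / b) with ((b - a) ^ 2 * / (a * b)) by (field; lra).
    rewrite <- Rinv_mult. apply Rmult_le_compat_l; [apply pow2_ge_0|].
    apply Rinv_le_contravar; [apply Rmult_lt_0_compat; apply pow_lt; lra|].
    replace (k ^ 2 * m ^ 2) with ((k * m) * (k * m)) by ring.
    apply Rmult_le_compat; nra.
Qed.

Lemma psi_series (z : R) : 0 < z -> psi z = - euler_mascheroni + Series (psi_term z).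
Proof.
  intros Hz. unfold psi.
  set (h := fun y => ln (Gamma 1) - euler_mascheroni * (y - 1) + Series (ln_Gamma_term y)).
  assert (E : forall y, 0 < y -> Gamma y = exp (h y)).
  { intros y Hy. unfold h. rewrite <- ln_Gamma_series by exact Hy.
    now rewrite exp_ln by now apply Gamma_pos. }
  assert (Dh : is_derive h z (- euler_mascheroni + Series (psi_term z))).
  { unfold h. apply (is_derive_plus (fun y => ln (Gamma 1) - euler_mascheroni * (y - 1))
                      (fun y => Series (ln_Gamma_term y))).
    - auto_derive; [exact I|ring].
    - now apply is_derive_ln_Gamma_series. }
  assert (DG : is_derive Gamma z (scal (- euler_mascheroni + Series (psi_term z)) (exp (h z)))).
  { apply (is_derive_ext_loc (fun y => exp (h y))).
    - apply (filter_imp (fun u => 0 < u)); [|apply open_gt; lra].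
      intros y Hy. symmetry. now apply E.
    - apply (is_derive_comp exp h); [apply is_derive_exp|exact Dh]. }
  rewrite (is_derive_unique _ _ _ DG), (E z Hz).
  unfold scal; simpl; unfold mult; simpl. field.
  assert (H := exp_pos (h z)). lra.
Qed.

Lemma is_derive_psi_series (z : R) : 0 < z ->
  is_derive (fun y => Series (psi_term y)) z (Series (psi'_term z)).
Proof.
  intros Hz. set (k := Rmin 1 (z / 2)).
  assert (Hk : 0 < k) by (apply Rmin_glb_lt; lra).
  assert (Hk1 : k <= 1) by apply Rmin_l. assert (Hkz : k <= z / 2) by apply Rmin_r.
  apply (is_derive_Series psi_term (psi'_term z)
           (fun n => / k ^ 3 * / (INR n + 1) ^ 2) z (z / 2)).
  - lra.
  - intros y Hy. apply ex_series_psi. apply half_neighbourhood in Hy. lra.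
  - now apply ex_series_psi'.
  - apply (ex_series_scal_l (V := R_NormedModule)). eexists. apply basel_series.
  - intros y n Hy. apply half_neighbourhood in Hy.
    assert (Hn := pos_INR n).
    assert (Hs := add_ge_scaled k z n Hk1 ltac:(lra)).
    assert (Hs' := add_ge_scaled k y n Hk1 ltac:(lra)).
    unfold psi_term, psi'_term.
    replace (1 / (INR n + 1) - 1 / (INR n + y) - (1 / (INR n + 1) - 1 / (INR n + z))
             - (y - z) * / (INR n + z) ^ 2)
      with (- ((y - z) ^ 2 * / ((INR n + z) ^ 2 * (INR n + y)))) by (field; lra).
    set (a := INR n + z) in *. set (b := INR n + y) in *. set (m := INR n + 1) in *.
    assert (Hm : 1 <= m) by (unfold m; lra).
    assert (Ha : 0 < a) by nra. assert (Hb : 0 < b) by nra.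
    assert (0 < a ^ 2 * b) by (apply Rmult_lt_0_compat; [apply pow_lt|]; lra).
    rewrite Rabs_Ropp, Rabs_pos_eq.
    2:{ apply Rmult_le_pos; [apply pow2_ge_0|]. left. now apply Rinv_0_lt_compat. }
    rewrite <- Rinv_mult. apply Rmult_le_compat_l; [apply pow2_ge_0|].
    apply Rinv_le_contravar; [apply Rmult_lt_0_compat; apply pow_lt; lra|].
    apply Rle_trans with ((k * m) ^ 2 * (k * 1)).
    + right. ring.
    + apply Rmult_le_compat; [apply pow2_ge_0|lra|apply pow_incr; nra|nra].
Qed.

Lemma psi'_series (z : R) : 0 < z -> psi' z = Series (psi'_term z).
Proof.
  intros Hz. unfold psi'.
  rewrite (Derive_ext_loc psi (fun y => - euler_mascheroni + Series (psi_term y))).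
  - apply is_derive_unique.
    replace (Series (psi'_term z)) with (0 + Series (psi'_term z)) by ring.
    apply (is_derive_plus (fun _ => - euler_mascheroni) (fun y => Series (psi_term y))).
    + apply (is_derive_const (- euler_mascheroni)).
    + now apply is_derive_psi_series.
  - apply (filter_imp (fun u => 0 < u)); [exact psi_series|]. apply open_gt. lra.
Qed.

(** * Monotonicity of f and g *)

Lemma psum_le_Series (a : nat -> R) (N : nat) :
  (forall n, 0 <= a n) -> ex_series a -> psum a N <= Series a.
Proof.
  intros Ha Hex. apply Series_correct, is_series_psum in Hex.
  apply (is_lim_seq_incr_compare _ _ Hex).
  intros n. apply psum_incr; [exact Ha|lia].
Qed.

Lemma term_le_Series (a : nat -> R) (k : nat) :
  (forall n, 0 <= a n) -> ex_series a -> a k <= Series a.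
Proof.
  intros Ha Hex. assert (H := psum_le_Series a (S k) Ha Hex).
  assert (H0 := psum_incr a Ha 0 k ltac:(lia)). simpl in *. lra.
Qed.

(** [Series b - Series a] is a series of nonnegative terms, hence at least its
    [k]-th term. *)
Lemma Series_lt (a b : nat -> R) (k : nat) :
  (forall n, a n <= b n) -> a k < b k -> ex_series a -> ex_series b ->
  Series a < Series b.
Proof.
  intros Hle Hlt Ha Hb.
  assert (H := term_le_Series (fun n => b n - a n) k).
  rewrite Series_minus in H by assumption.
  enough (b k - a k <= Series b - Series a) by lra.
  apply H.
  - intros n. specialize (Hle n). lra.
  - now apply (ex_series_minus (V := R_NormedModule)).
Qed.

(** The combination [1/m - 1/(m+x) - x/(m + x/2)^2], with [m = n + 1], over a
    common denominator: the numerator is a pure cube, so the sign is that of [x]. *)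
Definition f_term (x : R) (n : nat) : R :=
  x ^ 3 / ((INR n + 1) * (INR n + 1 + x) * (2 * (INR n + 1) + x) ^ 2).

Lemma f_term_eq (x : R) (n : nat) : -1 < x ->
  psi_term (x + 1) n - x * psi'_term (1 + x / 2) n = f_term x n.
Proof.
  intros Hx. assert (Hn := pos_INR n). unfold psi_term, psi'_term, f_term.
  field. repeat split; lra.
Qed.

Lemma ex_series_f_term (x : R) : -1 < x -> ex_series (f_term x).
Proof.
  intros Hx. eapply ex_series_ext; [intros n; now apply f_term_eq|].
  apply (ex_series_minus (V := R_NormedModule)); [apply ex_series_psi; lra|].
  apply (ex_series_scal_l (V := R_NormedModule)), ex_series_psi'. lra.
Qed.

Lemma fct_f_series (x : R) : -1 < x -> fct_f x = - euler_mascheroni + Series (f_term x).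
Proof.
  intros Hx. unfold fct_f. rewrite psi_series, psi'_series by lra.
  rewrite <- (Series_ext _ _ (fun n => f_term_eq x n Hx)).
  rewrite Series_minus, Series_scal_l.
  - ring.
  - apply ex_series_psi; lra.
  - apply (ex_series_scal_l (V := R_NormedModule)), ex_series_psi'. lra.
Qed.

(** This quadratic form is, up to the positive factor [y - x], the numerator of
    the difference of [f_term] at [y] and at [x]. In terms of [p = x + y] and
    [q = x * y] it equals [4 (m p + q)^2 + q^2 - 4 m^2 q], which settles [q <= 0].
    If both variables are negative it equals
    [4 m^2 (y - x)^2 + q (m^2 + 3 m (u + v) + 5 u v)] with [u = m + x] and
    [v = m + y], both positive. *)
Lemma f_numerator_pos (m x y : R) : 0 < m -> - m < x -> x < y ->
  0 < 4 * m ^ 2 * (x ^ 2 + x * y + y ^ 2) + 8 * m * (x * y) * (x + y) + 5 * (x * y) ^ 2.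
Proof.
  intros Hm Hx Hxy.
  assert (Hsq : 0 < (y - x) ^ 2) by (apply pow_lt; lra).
  assert (Hm2 : 0 < m ^ 2) by (apply pow_lt; lra).
  destruct (Rle_or_lt (x * y) 0) as [Hq|Hq].
  - replace (4 * m ^ 2 * (x ^ 2 + x * y + y ^ 2) + 8 * m * (x * y) * (x + y) + 5 * (x * y) ^ 2)
      with (4 * (m * (x + y) + x * y) ^ 2 + (x * y) ^ 2 + 4 * m ^ 2 * - (x * y)) by ring.
    assert (0 <= (x * y) ^ 2) by apply pow2_ge_0.
    assert (0 <= (m * (x + y) + x * y) ^ 2) by apply pow2_ge_0.
    destruct Hq as [Hq|Hq]; [nra|].
    rewrite Hq. replace (m * (x + y) + 0) with (m * (x + y)) by ring.
    rewrite Rpow_mult_distr.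
    replace ((x + y) ^ 2) with ((y - x) ^ 2 + 4 * (x * y)) by ring.
    rewrite Hq. nra.
  - destruct (Rle_or_lt 0 x) as [H0|H0].
    + assert (0 < m * (x * y) * (x + y)) by (repeat apply Rmult_lt_0_compat; nra).
      assert (0 < m ^ 2 * (x ^ 2 + x * y + y ^ 2)) by (apply Rmult_lt_0_compat; nra).
      nra.
    + assert (Hy : y < 0) by nra.
      assert (Hb : 0 < m ^ 2 + 3 * m * ((m + x) + (m + y)) + 5 * ((m + x) * (m + y))).
      { assert (0 < (m + x) * (m + y)) by (apply Rmult_lt_0_compat; lra).
        assert (0 < m * ((m + x) + (m + y))) by (apply Rmult_lt_0_compat; lra). lra. }
      assert (0 < m ^ 2 * (y - x) ^ 2) by now apply Rmult_lt_0_compat.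
      assert (Hp := Rmult_lt_0_compat _ _ Hq Hb). nra.
Qed.

Lemma f_term_increasing (n : nat) (x y : R) : -1 < x -> x < y -> f_term x n < f_term y n.
Proof.
  intros Hx Hxy. unfold f_term. assert (Hn := pos_INR n).
  set (m := INR n + 1). assert (Hm : 1 <= m) by (unfold m; lra).
  assert (HQ := f_numerator_pos m x y ltac:(lra) ltac:(lra) Hxy).
  set (Q := 4 * m ^ 2 * _ + _ + _) in HQ.
  assert (E : y ^ 3 / (m * (m + y) * (2 * m + y) ^ 2) - x ^ 3 / (m * (m + x) * (2 * m + x) ^ 2)
    = (y - x) * Q / ((m + y) * (2 * m + y) ^ 2 * ((m + x) * (2 * m + x) ^ 2))).
  { unfold Q. field. repeat split; lra. }
  enough (0 < (y - x) * Q / ((m + y) * (2 * m + y) ^ 2 * ((m + x) * (2 * m + x) ^ 2))) by lra.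
  apply Rdiv_lt_0_compat; [apply Rmult_lt_0_compat; lra|].
  repeat apply Rmult_lt_0_compat; lra || (apply pow_lt; lra).
Qed.

Lemma fct_f_increasing : strictly_increasing_on (fun x => -1 < x) fct_f.
Proof.
  intros x y Hx Hy Hxy. rewrite !fct_f_series by assumption.
  apply Rplus_lt_compat_l, (Series_lt _ _ 0).
  - intros n. left. now apply f_term_increasing.
  - now apply f_term_increasing.
  - now apply ex_series_f_term.
  - now apply ex_series_f_term.
Qed.

(** With [s = sqrt (x + 1)], so that [x = s^2 - 1], this is
    [(s^2 - 1)/(n+s)^2 - 1/(n+1) + 1/(n+s^2)] over a common denominator. *)
Definition g_term (s : R) (n : nat) : R :=
  INR n * (s + 1) * (s - 1) ^ 3 / ((INR n + s) ^ 2 * (INR n + 1) * (INR n + s ^ 2)).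

Lemma g_term_eq (s : R) (n : nat) : 0 < s ->
  (s ^ 2 - 1) * psi'_term s n - psi_term (s ^ 2) n = g_term s n.
Proof.
  intros Hs. assert (Hn := pos_INR n). unfold psi_term, psi'_term, g_term.
  field. repeat split; nra.
Qed.

Lemma ex_series_g_term (s : R) : 0 < s -> ex_series (g_term s).
Proof.
  intros Hs. eapply ex_series_ext; [intros n; now apply g_term_eq|].
  apply (ex_series_minus (V := R_NormedModule)).
  - now apply (ex_series_scal_l (V := R_NormedModule)), ex_series_psi'.
  - apply ex_series_psi, pow_lt, Hs.
Qed.

Lemma sqrt_shift (x : R) : -1 < x -> 0 < sqrt (x + 1) /\ sqrt (x + 1) ^ 2 = x + 1.
Proof.
  intros Hx. split; [apply sqrt_lt_R0; lra|apply pow2_sqrt; lra].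
Qed.

Lemma fct_g_series (x : R) : -1 < x ->
  fct_g x = euler_mascheroni + Series (g_term (sqrt (x + 1))).
Proof.
  intros Hx. destruct (sqrt_shift x Hx) as [Hs E].
  set (s := sqrt (x + 1)) in *. unfold fct_g. fold s.
  rewrite <- E. replace x with (s ^ 2 - 1) by lra.
  rewrite psi_series, psi'_series by (try apply pow_lt; exact Hs).
  rewrite <- (Series_ext _ _ (fun n => g_term_eq s n Hs)).
  rewrite Series_minus, Series_scal_l.
  - ring.
  - now apply (ex_series_scal_l (V := R_NormedModule)), ex_series_psi'.
  - apply ex_series_psi, pow_lt, Hs.
Qed.

(** The mean value theorem on either side of the exceptional point [c]. *)
Lemma increasing_of_derive_pos_except (h dh : R -> R) (c : R) :
  (forall s, 0 < s -> is_derive h s (dh s)) ->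
  (forall s, 0 < s -> s <> c -> 0 < dh s) ->
  forall s t, 0 < s -> s < t -> h s < h t.
Proof.
  intros Hd Hp.
  assert (H0 : forall s t, 0 < s -> s < t -> ~ (s < c < t) -> h s < h t).
  { intros s t Hs Hst Hc.
    destruct (MVT_cor2 h dh s t Hst) as (u & E & Hu).
    - intros u Hu. apply is_derive_Reals, Hd. lra.
    - assert (0 < dh u) by (apply Hp; [lra|intros ->; tauto]). nra. }
  intros s t Hs Hst.
  destruct (classic (s < c < t)) as [H|H]; [|now apply H0].
  apply Rlt_trans with (h c); apply H0; lra.
Qed.

(** In the numerator of the derivative the coefficient of [n^2] is
    [2 s^3 - 3 s^2 + 1 = (s - 1)^2 (2 s + 1)] and that of [n] is
    [s^5 - 3 s^3 + 2 s^2 = s^2 (s - 1)^2 (s + 2)], so the only critical point is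
    [s = 1], where both [g_term] and the numerator of the derivative vanish. *)
Lemma g_term_increasing (n : nat) (s t : R) : (0 < n)%nat -> 0 < s -> s < t ->
  g_term s n < g_term t n.
Proof.
  intros Hn. assert (Hm : 0 < INR n) by now apply lt_0_INR. unfold g_term.
  set (m := INR n) in *. revert s t.
  apply (increasing_of_derive_pos_except _
    (fun s => 2 * m * (s - 1) ^ 2 * (m * (2 * s + 1) + s ^ 2 * (s + 2))
                / ((m + s) ^ 3 * (m + s ^ 2) ^ 2)) 1).
  - intros s Hs. assert (0 < s ^ 2) by now apply pow_lt.
    auto_derive.
    + assert (0 < m + s) by lra. assert (0 < m + s * (s * 1)) by (simpl in *; lra).
      repeat apply Rmult_integral_contrapositive_currified; lra.
    + field. repeat split; lra.
  - intros s Hs Hs1. assert (0 < s ^ 2) by now apply pow_lt.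
    assert (0 < (s - 1) ^ 2) by (apply pow2_gt_0; lra).
    apply Rdiv_lt_0_compat.
    + apply Rmult_lt_0_compat; nra.
    + apply Rmult_lt_0_compat; apply pow_lt; lra.
Qed.

Lemma g_term_0 (s : R) : g_term s 0 = 0.
Proof. unfold g_term. simpl INR. unfold Rdiv. ring. Qed.

Lemma fct_g_increasing : strictly_increasing_on (fun x => -1 < x) fct_g.
Proof.
  intros x y Hx Hy Hxy. rewrite !fct_g_series by assumption.
  destruct (sqrt_shift x Hx) as [Hs _]. destruct (sqrt_shift y Hy) as [Ht _].
  assert (Hst : sqrt (x + 1) < sqrt (y + 1)) by (apply sqrt_lt_1; lra).
  apply Rplus_lt_compat_l, (Series_lt _ _ 1).
  - intros [|n]; [rewrite !g_term_0; lra|]. left. apply g_term_increasing; [lia|lra..].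
  - apply g_term_increasing; [lia|lra..].
  - now apply ex_series_g_term.
  - now apply ex_series_g_term.
Qed.

(** For [x < 0] all terms are negative, and the term of index 0 contains the
    factor [1 / (1 + x)], which alone forces divergence: on [(-1, -1/2)] it is at
    most [- 1 / (18 (1 + x))]. *)
Lemma fct_f_lim_left : filterlim fct_f (at_right (-1)) (Rbar_locally m_infty).
Proof.
  intros P [M HP]. set (K := Rabs M + Rabs euler_mascheroni + 1).
  assert (HK : 0 < K).
  { unfold K. assert (H1 := Rabs_pos M). assert (H2 := Rabs_pos euler_mascheroni). lra. }
  assert (Hd : 0 < Rmin (/ 2) (/ (18 * K))).
  { apply Rmin_glb_lt; [lra|]. apply Rinv_0_lt_compat. lra. }
  exists (mkposreal _ Hd). intros x Hx Hx1. apply HP.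
  apply Rabs_lt_between' in Hx. simpl in Hx.
  assert (Hl := Rmin_l (/ 2) (/ (18 * K))). assert (Hr := Rmin_r (/ 2) (/ (18 * K))).
  rewrite fct_f_series by exact Hx1.
  assert (Hneg : forall n, 0 <= - f_term x n).
  { intros n. unfold f_term. assert (Hn := pos_INR n).
    replace (- (x ^ 3 / ((INR n + 1) * (INR n + 1 + x) * (2 * (INR n + 1) + x) ^ 2)))
      with ((- x) ^ 3 / ((INR n + 1) * (INR n + 1 + x) * (2 * (INR n + 1) + x) ^ 2))
      by (field; lra).
    apply Rdiv_le_0_compat; [apply pow_le; lra|].
    repeat apply Rmult_lt_0_compat; lra. }
  assert (H := term_le_Series (fun n => - f_term x n) 0 Hneg
    (ex_series_opp (V := R_NormedModule) _ (ex_series_f_term x Hx1))).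
  rewrite Series_opp in H. unfold f_term in H at 1. simpl INR in H.
  assert (H1 : K < - (x ^ 3 / ((0 + 1) * (0 + 1 + x) * (2 * (0 + 1) + x) ^ 2))).
  { replace (- (x ^ 3 / ((0 + 1) * (0 + 1 + x) * (2 * (0 + 1) + x) ^ 2)))
      with ((- x) ^ 3 / ((1 + x) * (2 + x) ^ 2)) by (field; lra).
    assert (H18 : 18 * K < / (1 + x)).
    { rewrite <- (Rinv_inv (18 * K)). apply Rinv_lt_contravar; [|lra].
      apply Rmult_lt_0_compat; [lra|apply Rinv_0_lt_compat; lra]. }
    apply Rlt_le_trans with (/ 18 * / (1 + x)); [lra|].
    apply Rmult_le_reg_r with (18 * (1 + x) * (2 + x) ^ 2).
    { repeat apply Rmult_lt_0_compat; lra. }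
    replace (/ 18 * / (1 + x) * (18 * (1 + x) * (2 + x) ^ 2)) with ((2 + x) ^ 2)
      by (field; lra).
    replace ((- x) ^ 3 / ((1 + x) * (2 + x) ^ 2) * (18 * (1 + x) * (2 + x) ^ 2))
      with (18 * (- x) ^ 3) by (field; lra).
    assert ((2 + x) ^ 2 <= (3 / 2) ^ 2) by (apply pow_incr; lra).
    assert ((/ 2) ^ 3 <= (- x) ^ 3) by (apply pow_incr; lra). simpl in *; lra. }
  assert (H2 := Rle_abs (- M)). rewrite Rabs_Ropp in H2.
  assert (H3 := Rle_abs (- euler_mascheroni)). rewrite Rabs_Ropp in H3.
  unfold K in H1. lra.
Qed.

Lemma harmonic_unbounded (A : R) : exists N, A < harmonic N.
Proof.
  assert (H : forall n, ln (INR n + 1) <= harmonic n).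
  { unfold harmonic. induction n as [|n IH]; [simpl; rewrite Rplus_0_l, ln_1; lra|].
    cbn [psum]. rewrite S_INR. assert (Hn := pos_INR n).
    destruct (ln_diff_bounds (INR n + 1) (INR n + 1 + 1) ltac:(lra) ltac:(lra)) as [_ H2].
    replace ((INR n + 1 + 1 - (INR n + 1)) / (INR n + 1)) with (/ (INR n + 1)) in H2
      by (field; lra). lra. }
  destruct (nfloor_ex (exp A)) as [N HN]; [left; apply exp_pos|].
  exists N. eapply Rlt_le_trans; [|apply H].
  rewrite <- (ln_exp A) at 1. apply ln_increasing; [apply exp_pos|lra].
Qed.

(** For [m <= x] the denominator of the term is at most
    [m (2 x) (3 x)^2 = 18 m x^3], so the partial sum up to [x] dominates a fixed
    fraction of the harmonic sum. *)
Lemma fct_f_lim_right : filterlim fct_f (Rbar_locally p_infty) (Rbar_locally p_infty).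
Proof.
  intros P [M HP].
  destruct (harmonic_unbounded (18 * (M + euler_mascheroni))) as [N HN].
  exists (INR N). intros x Hx. apply HP. assert (HN0 := pos_INR N).
  rewrite fct_f_series by lra.
  assert (Hpos : forall n, 0 <= f_term x n).
  { intros n. unfold f_term. assert (Hn := pos_INR n).
    apply Rdiv_le_0_compat; [apply pow_le; lra|].
    repeat apply Rmult_lt_0_compat; lra. }
  assert (H := psum_le_Series _ N Hpos (ex_series_f_term x ltac:(lra))).
  enough (/ 18 * harmonic N <= psum (f_term x) N) by lra.
  unfold harmonic. rewrite <- psum_scal. apply psum_le. intros k Hk.
  assert (Hk' : INR k + 1 <= INR N) by (rewrite <- S_INR; apply le_INR; lia).
  assert (Hk0 := pos_INR k). unfold f_term. set (m := INR k + 1) in *.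
  assert (Hm : 1 <= m) by (unfold m; lra).
  rewrite <- Rinv_mult.
  apply Rmult_le_reg_r with (18 * m * (m * (m + x) * (2 * m + x) ^ 2)).
  { repeat apply Rmult_lt_0_compat; lra. }
  replace (/ (18 * m) * (18 * m * (m * (m + x) * (2 * m + x) ^ 2)))
    with (m * ((m + x) * (2 * m + x) ^ 2)) by (field; lra).
  replace (x ^ 3 / (m * (m + x) * (2 * m + x) ^ 2)
             * (18 * m * (m * (m + x) * (2 * m + x) ^ 2)))
    with (m * ((2 * x) * (3 * x) ^ 2)) by (field; lra).
  apply Rmult_le_compat_l; [lra|].
  apply Rmult_le_compat; [lra|apply pow2_ge_0|lra|apply pow_incr; lra].
Qed.

(** For [1 <= n <= s] and [s >= 2] each term is at least [1/128], so the sum over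
    these [n] grows linearly in [s]. *)
Lemma fct_g_lim_right : filterlim fct_g (Rbar_locally p_infty) (Rbar_locally p_infty).
Proof.
  intros P [M HP].
  destruct (nfloor_ex (Rmax 0 (128 * (M - euler_mascheroni)))) as [N [_ HN]]; [apply Rmax_l|].
  assert (Hmax := Rmax_r 0 (128 * (M - euler_mascheroni))).
  exists ((INR N + 3) ^ 2). intros x Hx. apply HP. assert (HN0 := pos_INR N).
  assert (H9 : 0 < (INR N + 3) ^ 2) by (apply pow_lt; lra).
  rewrite fct_g_series by lra.
  destruct (sqrt_shift x ltac:(lra)) as [Hs0 E]. set (s := sqrt (x + 1)) in *.
  assert (Hs : INR N + 3 < s).
  { apply Rnot_le_lt. intros Hle. assert (s ^ 2 <= (INR N + 3) ^ 2) by (apply pow_incr; lra).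
    lra. }
  assert (Hpos : forall n, 0 <= g_term s n).
  { intros n. unfold g_term. assert (Hn := pos_INR n).
    assert (0 < s ^ 2) by (apply pow_lt; lra).
    apply Rdiv_le_0_compat.
    - apply Rmult_le_pos; [apply Rmult_le_pos; lra|apply pow_le; lra].
    - repeat apply Rmult_lt_0_compat; lra. }
  assert (H := psum_le_Series _ (S (S N)) Hpos (ex_series_g_term s Hs0)).
  enough (INR (S N) * / 128 <= psum (g_term s) (S (S N))) by (rewrite S_INR in *; lra).
  rewrite psum_shift, g_term_0, Rplus_0_l, <- psum_const. apply psum_le. intros k Hk.
  unfold g_term.
  assert (Hm : 1 <= INR (S k) <= s).
  { rewrite S_INR. assert (Hk0 := pos_INR k).
    assert (INR k <= INR N) by (apply le_INR; lia). lra. }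
  set (m := INR (S k)) in *.
  assert (0 < s ^ 2) by (apply pow_lt; lra).
  set (D := (m + s) ^ 2 * (m + 1) * (m + s ^ 2)).
  assert (HD : 0 < D) by (unfold D; repeat apply Rmult_lt_0_compat; lra).
  apply Rmult_le_reg_r with D; [exact HD|].
  replace (m * (s + 1) * (s - 1) ^ 3 / D * D) with (m * ((s + 1) * (s - 1) ^ 3))
    by (field; lra).
  (* Numerator at least m * s^4 / 8, denominator at most 16 * m * s^4. *)
  assert (U : D <= (2 * s) ^ 2 * (2 * m) * (2 * s ^ 2)).
  { unfold D. assert (s <= s ^ 2) by nra.
    apply Rmult_le_compat; [repeat apply Rmult_le_pos; lra|lra| |lra].
    apply Rmult_le_compat; [apply pow2_ge_0|lra|apply pow_incr; lra|lra]. }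
  assert (L : s * (s / 2) ^ 3 <= (s + 1) * (s - 1) ^ 3).
  { apply Rmult_le_compat; [lra|apply pow_le; lra|lra|apply pow_incr; lra]. }
  apply (Rmult_le_compat_l m) in L; [|lra].
  eapply Rle_trans; [|exact L]. eapply Rle_trans.
  { apply Rmult_le_compat_l; [lra|exact U]. }
  right. field.
Qed.

(** The limit of [g_term s (k + 1)] as [s] tends to 0. The index is shifted past
    the term of index 0, which vanishes identically. *)
Definition g_limit_term (k : nat) : R := - / ((INR k + 1) ^ 2 * (INR k + 2)).

(** [- 1/(m^2 (m+1)) = (1/m - 1/(m+1)) - 1/m^2], a telescoping series minus the
    sum of inverse squares. *)
Lemma g_limit_series : is_series g_limit_term (1 - PI ^ 2 / 6).
Proof.
  apply is_series_psum.
  apply (is_lim_seq_ext (fun n => (1 - 1 / (INR n + 1)) - psum (fun k => / (INR k + 1) ^ 2) n)).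
  - induction n as [|n IH]; [simpl; field|].
    cbn [psum]. rewrite <- IH, S_INR. unfold g_limit_term. assert (Hn := pos_INR n).
    field. lra.
  - replace (1 - PI ^ 2 / 6) with ((1 - 0) - PI ^ 2 / 6) by ring.
    apply is_lim_seq_minus'; [|apply is_series_psum, basel_series].
    apply is_lim_seq_minus'; [apply is_lim_seq_const|apply is_lim_seq_inv_shift].
Qed.

Lemma g_term_near_0 (s : R) (k : nat) : 0 < s < 1 ->
  Rabs (g_term s (S k) - g_limit_term k) <= 4 * s * / (INR k + 1) ^ 2.
Proof.
  intros Hs. unfold g_term, g_limit_term. rewrite S_INR.
  assert (Hk := pos_INR k). replace (INR k + 2) with (INR k + 1 + 1) by ring.
  set (m := INR k + 1). assert (Hm : 1 <= m) by (unfold m; lra).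
  assert (Hs2 : 0 < s ^ 2) by (apply pow_lt; lra).
  assert (Hss : s ^ 2 <= s) by nra.
  (* A = (s^2-1)/(m+s)^2 + 1/m^2 and B = 1/m - 1/(m+s^2) are the two differences
     from the value at s = 0; both lie in [0, 4 s / m^2]. *)
  set (A := (s ^ 2 * m ^ 2 + 2 * m * s + s ^ 2) / (m ^ 2 * (m + s) ^ 2)).
  set (B := s ^ 2 / (m * (m + s ^ 2))).
  replace (_ - _) with (A - B).
  2:{ unfold A, B. field. repeat split; nra. }
  assert (Hm2 : 1 <= m ^ 2) by (apply pow_R1_Rle; lra).
  assert (HA : 0 <= A <= 4 * s * / m ^ 2).
  { unfold A. split.
    - apply Rdiv_le_0_compat; [nra|]. apply Rmult_lt_0_compat; apply pow_lt; lra.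
    - apply Rmult_le_reg_r with (m ^ 2 * (m + s) ^ 2).
      { apply Rmult_lt_0_compat; apply pow_lt; lra. }
      replace ((s ^ 2 * m ^ 2 + 2 * m * s + s ^ 2) / (m ^ 2 * (m + s) ^ 2)
         * (m ^ 2 * (m + s) ^ 2)) with (s ^ 2 * m ^ 2 + 2 * m * s + s ^ 2) by (field; lra).
      replace (4 * s * / m ^ 2 * (m ^ 2 * (m + s) ^ 2)) with (4 * s * (m + s) ^ 2)
        by (field; lra).
      assert (s ^ 2 * m ^ 2 <= s * m ^ 2) by (apply Rmult_le_compat_r; lra).
      assert (m * s <= m ^ 2 * s) by nra.
      assert (s * m ^ 2 <= s * (m + s) ^ 2).
      { apply Rmult_le_compat_l; [lra|]. apply pow_incr; lra. }
      nra. }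
  assert (HB : 0 <= B <= 4 * s * / m ^ 2).
  { unfold B. split.
    - apply Rdiv_le_0_compat; [lra|nra].
    - unfold Rdiv. apply Rmult_le_compat; [lra|left; apply Rinv_0_lt_compat; nra|lra|].
      apply Rinv_le_contravar; nra. }
  apply Rabs_le. lra.
Qed.

(** The uniform bound [4 s / m^2] on the difference of the terms allows passing to
    the limit inside the sum. *)
Lemma fct_g_lim_left :
  filterlim fct_g (at_right (-1)) (locally (1 + euler_mascheroni - PI ^ 2 / 6)).
Proof.
  apply filterlim_locally. intros eps. assert (Heps := cond_pos eps).
  assert (HPI : 0 < PI ^ 2) by apply pow_lt, PI_RGT_0.
  set (K := 4 * (PI ^ 2 / 6)). assert (HK : 0 < K) by (unfold K; lra).
  set (eta := Rmin 1 (eps / K)).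
  assert (Heta : 0 < eta) by (apply Rmin_glb_lt; [lra|now apply Rdiv_lt_0_compat]).
  assert (Hd : 0 < eta ^ 2) by now apply pow_lt.
  exists (mkposreal _ Hd). intros x Hx Hx1. apply Rabs_lt_between' in Hx. simpl pos in Hx.
  destruct (sqrt_shift x Hx1) as [Hs0 E]. rewrite fct_g_series by exact Hx1.
  set (s := sqrt (x + 1)) in *.
  assert (Hs : s < eta).
  { apply Rnot_le_lt. intros Hle. assert (eta ^ 2 <= s ^ 2) by (apply pow_incr; lra). lra. }
  assert (He1 : eta <= 1) by apply Rmin_l. assert (He2 : eta <= eps / K) by apply Rmin_r.
  assert (Hex : ex_series (fun k => g_term s (S k))).
  { now apply (proj1 (ex_series_incr_1 (V := R_NormedModule) (g_term s))), ex_series_g_term. }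
  assert (Hlim := g_limit_series).
  rewrite Series_incr_1, g_term_0, Rplus_0_l by now apply ex_series_g_term.
  change (Rabs (euler_mascheroni + Series (fun k => g_term s (S k))
            - (1 + euler_mascheroni - PI ^ 2 / 6)) < eps).
  replace (euler_mascheroni + Series (fun k => g_term s (S k))
            - (1 + euler_mascheroni - PI ^ 2 / 6))
    with (Series (fun k => g_term s (S k)) - (1 - PI ^ 2 / 6)) by ring.
  rewrite <- (is_series_unique _ _ Hlim), <- Series_minus;
    [|exact Hex|now exists (1 - PI ^ 2 / 6)].
  apply Rle_lt_trans with (Series (fun k => 4 * s * / (INR k + 1) ^ 2)).
  - apply Series_Rabs_le.
    + intros k. apply g_term_near_0. lra.
    + apply (ex_series_scal_l (V := R_NormedModule)). eexists. apply basel_series.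
  - rewrite Series_scal_l, (is_series_unique _ _ basel_series).
    replace (4 * s * (PI ^ 2 / 6)) with (s * K) by (unfold K; ring).
    apply Rlt_le_trans with (eps / K * K); [apply Rmult_lt_compat_r; lra|].
    right. field. lra.
Qed.

Theorem theorem4 :
  strictly_increasing_on (fun x : R => -1 < x) fct_f /\
  strictly_increasing_on (fun x : R => -1 < x) fct_g /\
  filterlim fct_f (at_right (-1)) (Rbar_locally m_infty) /\
  filterlim fct_g (at_right (-1)) (locally (1 + euler_mascheroni - PI ^ 2 / 6)) /\
  filterlim fct_f (Rbar_locally p_infty) (Rbar_locally p_infty) /\
  filterlim fct_g (Rbar_locally p_infty) (Rbar_locally p_infty).
Proof.
  exact (conj fct_f_increasing (conj fct_g_increasing (conj fct_f_lim_left
           (conj fct_g_lim_left (conj fct_f_lim_right fct_g_lim_right))))).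
Qed.
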